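(* In the setting described in the context, for every small enough absolute constant $\varepsilon>0$ and every large enough $n$ (possibly depending on $\varepsilon$), with non-zero probability over $G_X\sim\mathrm{Ext}(G,H)$ there is no subgraph $G'$ of $G$ and map $\bar f:V_{G'}\to X$ such that $\bar f$ is an $(\varepsilon\log^{4/3}n,\varepsilon)$-split.
   Context: Fix an integer $d\ge 3$. Let $G=(V_G,E_G)$ and $H=(V_H,E_H)$ be graphs with $n$ vertices each, both expanders that are Cayley graphs of groups with respect to $d$ generators (so of constant bounded degree $d$), and let $G$ have girth $\Omega(\log n)$. Here $\log$ is the natural logarithm. Give every edge of $G$ length $\log^{2/3}n$ and every edge of $H$ length $\log^{1/3}n$. The randomized extension $\mathrm{Ext}(G,H)$ is the random graph $G_X$ on vertex set $X=V_G\times V_H$ with the following edges: for each $g\in V_G$, $((g,h_1),(g,h_2))$ is an edge iff $(h_1,h_2)\in E_H$ (intra-cloud edge, length $\log^{1/3}n$); and for each $(g_1,g_2)\in E_G$, independently, a uniformly random perfect matching between $\{g_1\}\times V_H$ and $\{g_2\}\times V_H$ is added (inter-cloud edges, length $\log^{2/3}n$). Denote the length function by $\ell$, by $D_X$ the shortest-path metric of $G_X$ w.r.t. $\ell$, and by $\pi:X\to V_G$ the projection $\pi((g,h))=g$. Cycle-homeomorphism: for a subgraph $G'=(V_{G'},E_{G'})$ of $G$, a map $\tilde f:V_{G'}\to V_G$ and an assignment $P_{\tilde f}$ giving to each $(u,v)\in E_{G'}$ a path (walk) in $G$ from $\tilde f(u)$ to $\tilde f(v)$, the pair $(\tilde f,P_{\tilde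 f})$ is a cycle-homeomorphism of $G$ w.r.t. $G'$ if for every simple cycle $C\subseteq E_{G'}$, the set of edges of $G$ appearing an odd number of times (with multiplicity) in the paths $P_{\tilde f}(e')$, $e'\in C$, equals $C$. Split: a map $\bar f:V_{G'}\to X$ is an $(\alpha,\varepsilon)$-split if $G'=(V_{G'},E_{G'})$ is a subgraph of $G$ with $|E_{G'}|\ge(1-\varepsilon)|E_G|$ such that: (1) letting, for $(g_1,g_2)\in E_{G'}$, $P_{\pi\circ\bar f}((g_1,g_2))$ be the image under $\pi$ (collapsing intra-cloud edges) of the shortest path w.r.t. $\ell$ in the whole graph $G_X$ between $\bar f(g_1)$ and $\bar f(g_2)$, the pair $(\pi\circ\bar f,P_{\pi\circ\bar f})$ is a cycle-homeomorphism of $G$ w.r.t. $G'$; (2) $D_X(\bar f(g_1),\bar f(g_2))<\alpha$ for every $(g_1,g_2)\in E_{G'}$; (3) for every $g\in V_{G'}$, the shortest path in $G$ between $g$ and $\pi\circ\bar f(g)$ has at most $\varepsilon\log n$ edges. *)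

(* Defs.v *)
From HB Require Import structures.
From mathcomp Require Import all_boot all_order all_algebra all_fingroup.
From mathcomp Require Import all_classical all_reals all_analysis.
Set Implicit Arguments.
Unset Strict Implicit.
Unset Printing Implicit Defensive.
Import Order.TTheory GRing.Theory Num.Theory.
Local Open Scope ring_scope.

Record sgraph := SGraph {
  svertex :> finType;
  sedge : rel svertex;
  sedge_sym : symmetric sedge;
  sedge_irr : irreflexive sedge }.

(** Undirected edges are two-element sets of vertices. *)
Definition edges (G : sgraph) : {set {set G}} :=
  [set e : {set G} | [exists x, exists y, sedge x y && (e == [set x; y]%SET)]]%SET.

Section Walks.
Variables (R : realType) (G : sgraph).

(** A walk is a starting vertex together with the list of the subsequent
    vertices.  It is an object of an undirected graph, so it is said to run
    between [x] and [y] whichever of the two is its starting vertex. *)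
Definition walk : Type := (G * seq G)%type.

Definition walk_between (x y : G) (w : walk) : Prop :=
  path (@sedge G) w.1 w.2 /\ ([set w.1; last w.1 w.2] = [set x; y])%SET.

Definition walk_edges (w : walk) : seq {set G} :=
  pairmap (fun a b => [set a; b]%SET) w.1 w.2.

Definition walk_length (l : G -> G -> R) (w : walk) : R :=
  \sum_(t <- pairmap l w.1 w.2) t.

Definition shortest_path (l : G -> G -> R) (x y : G) (w : walk) : Prop :=
  walk_between x y w /\
  forall w', walk_between x y w' -> walk_length l w <= walk_length l w'.

Definition path_dist (l : G -> G -> R) (x y : G) : \bar R :=
  ereal_inf [set (walk_length l w)%:E | w in [set w | walk_between x y w]]%classic.

End Walks.

Definition simple_cycle (T : eqType) (e : rel T) (c : seq T) : bool :=
  [&& (2 < size c)%N, uniq c & path.cycle e c].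

Definition cycle_edges (T : finType) (c : seq T) : {set {set T}} :=
  [set [set x; next c x] | x in c]%SET.

Definition girth (R : realType) (G : sgraph) : \bar R :=
  ereal_inf [set (size c)%:R%:E | c in [set c | simple_cycle (@sedge G) c]]%classic.

(** [phi] is a lower bound on the edge expansion of [G]. *)
Definition expander (R : realType) (phi : R) (G : sgraph) : Prop :=
  forall A : {set G}, (2 * #|A| <= #|G|)%N ->
    phi * #|A|%:R <=
    #|[set p : G * G | [&& p.1 \in A, p.2 \notin A & sedge p.1 p.2]]%SET|%:R.

(** [S] is the whole connection set, inverses included, so that the graph is
    [d]-regular. *)
Definition cayley_graph (d : nat) (G : sgraph) : Prop :=
  exists (gT : finGroupType) (S : {set gT}) (f : G -> gT),
    [/\ #|S| = d, 1%g \notin S, (S^-1 = S)%g & <<S>>%g = [set: gT]%SET] /\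
    bijective f /\
    forall x y, sedge x y = ((f x)^-1 * f y \in S)%g.

Section Subgraphs.
Variables (G : sgraph) (V' : {set G}) (E' : {set {set G}}).

Definition subgraph : Prop :=
  E' \subset edges G /\ forall e, e \in E' -> e \subset V'.

(** [f] and [P] are total functions, of which only the values on [V'] and on
    [E'] matter. *)
Definition cycle_homeomorphism (f : G -> G) (P : {set G} -> walk G) : Prop :=
  (forall u v, [set u; v]%SET \in E' ->
     walk_between (f u) (f v) (P [set u; v]%SET)) /\
  (forall c, simple_cycle (fun u v => [set u; v]%SET \in E') c ->
     [set e in edges G |
        odd (\sum_(e' in cycle_edges c) count_mem e (walk_edges (P e')))]%SET
     = cycle_edges c).

End Subgraphs.

Section RandomizedExtension.
Variables (R : realType) (G H : sgraph).

(** Each undirected edge of [G], listed once, with an arbitrary orientation. *)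
Definition oriented_edge : predArgType :=
  {p : G * G | sedge p.1 p.2 && (enum_rank p.1 < enum_rank p.2)%N}.

(** For an edge [(g1, g2)], the permutation [s] stands for the perfect matching
    [{((g1, h), (g2, s h)) | h in H}] between the two clouds. *)
Definition matchings : predArgType := {ffun oriented_edge -> {perm H}}.

(** Probability of an event when the matchings are independent and uniform. *)
Definition ext_prob (A : matchings -> Prop) : R :=
  \sum_(m : matchings | `[< A m >])
    \prod_(e : oriented_edge) (#|{perm H}|%:R)^-1.

Variable m : matchings.

Definition intra_edge : rel (G * H) :=
  fun x y => (x.1 == y.1) && sedge x.2 y.2.

Definition inter_edge : rel (G * H) := fun x y =>
  [exists e : oriented_edge,
    ((val e == (x.1, y.1)) && (m e x.2 == y.2))
    || ((val e == (y.1, x.1)) && (m e y.2 == x.2))].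

Definition ext_edge : rel (G * H) :=
  fun x y => intra_edge x y || inter_edge x y.

Lemma ext_edge_sym : symmetric ext_edge.
Proof.
move=> x y; rewrite /ext_edge /intra_edge eq_sym sedge_sym; congr (_ || _).
by apply: eq_existsb => e; rewrite orbC.
Qed.

Lemma ext_edge_irr : irreflexive ext_edge.
Proof.
move=> x; rewrite /ext_edge /intra_edge sedge_irr andbF /=.
apply/existsP => -[e]; rewrite orbb => /andP[/eqP ve _].
by have := valP e; rewrite /= ve /= sedge_irr.
Qed.

Definition ext_graph : sgraph := SGraph ext_edge_sym ext_edge_irr.

Definition ext_length (x y : ext_graph) : R :=
  if x.1 == y.1 then ln #|G|%:R `^ (1 / 3) else ln #|G|%:R `^ (2 / 3).

Fixpoint destutter (T : eqType) (x : T) (s : seq T) : seq T :=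
  if s is y :: s' then
    if x == y then destutter x s' else y :: destutter y s'
  else [::].

Definition project (w : walk ext_graph) : walk G :=
  (w.1.1, destutter w.1.1 [seq x.1 | x <- w.2]).

(** Shortest paths need not be unique: [Q] is any choice of one for each edge
    of the subgraph. *)
Definition is_split (alpha eps : R) (V' : {set G}) (E' : {set {set G}})
    (f : G -> ext_graph) : Prop :=
  [/\ subgraph V' E',
      (1 - eps) * #|edges G|%:R <= #|E'|%:R,
      exists Q : {set G} -> walk ext_graph,
        (forall g1 g2, [set g1; g2]%SET \in E' ->
           shortest_path ext_length (f g1) (f g2) (Q [set g1; g2]%SET)) /\
        cycle_homeomorphism E' (fun g => (f g).1) (fun e => project (Q e)),
      forall g1 g2, [set g1; g2]%SET \in E' ->
        (path_dist ext_length (f g1) (f g2) < alpha%:E)%E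
    & forall g, g \in V' ->
        exists2 w : walk G, shortest_path (fun _ _ => 1 : R) g (f g).1 w
          & (size w.2)%:R <= eps * ln #|G|%:R].

End RandomizedExtension.

(* Main.v *)
Require Import Defs.
From HB Require Import structures.
From mathcomp Require Import all_boot all_order all_algebra all_fingroup zify.
Set Implicit Arguments.
Unset Strict Implicit.
Unset Printing Implicit Defensive.
Import Order.TTheory GRing.Theory Num.Theory.
Local Open Scope set_scope.

(** A split of [m] maps [G'] into [X]; let [Y] be the union of the shortest paths
    [Q e], [e] in [E']. Each has at most [s = eps log n] edges, so by condition (3)
    [Y] meets every cloud in at most [K = n ^ O(eps)] points.

    The cycle-homeomorphism condition extends from simple cycles to all even edge
    sets [C] over F_2: the projected lift of [C] is [C]. Since
    [|E'| >= (1 - eps) 3n/2], linear algebra gives [k = n/8] inter-cloud edges [F]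
    of [Y], over distinct edges of [G], such that removing [F] does not change the
    components of [Y]. Hence [Y] minus [F] is visited by a tour of length
    [O(eps n log n)] with [O(eps n)] jumps (one for each edge of [G] that is not in
    [E']), which is encoded by [n ^ (O(eps) n)] words and which never uses [F].

    Given the vertices visited, an edge of [F] is named by its edge of [G] and by
    two indices below [K], so that there are [n ^ (O(eps) n)] codes in all. For a
    fixed code each of the [k] matching edges in [F] is forced, which by switching
    has probability at most [1 / (n - K)] per edge. The codes are fewer than
    [(n - K) ^ k], so some [m] has no code. *)

(** * Even edge sets *)

Section Parity.
Variable T : finType.
Implicit Types (C : {set T}) (c : T -> bool).

(** With [bool] as the field F_2, sets are vectors, [symdiff] is their sum, and [parity ^~ c] is the
    linear form with coefficients [c]. *)
Definition parity C c : bool := \big[addb/false]_(x in C) c x.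

Definition symdiff C1 C2 : {set T} := [set x | (x \in C1) (+) (x \in C2)]%SET.

Lemma parity_symdiff C1 C2 c :
  parity (symdiff C1 C2) c = parity C1 c (+) parity C2 c.
Proof.
rewrite /parity [LHS]big_mkcond [X in X (+) _]big_mkcond [X in _ (+) X]big_mkcond /=.
rewrite -big_split; apply: eq_bigr => x _.
by rewrite inE; case: (x \in C1); case: (x \in C2); case: (c x).
Qed.

Lemma odd_count_xor (p : pred T) (s : seq T) :
  odd (count p s) = \big[addb/false]_(y | p y) odd (count_mem y s).
Proof.
elim: s => [|x s IHs] /=; first by rewrite big1.
under eq_bigr do rewrite oddD oddb.
rewrite big_split /= -IHs oddD oddb; congr (_ (+) _).
have [px|npx] := boolP (p x).
  rewrite (bigD1 x) //= eqxx big1 //= => y /andP[_ /negPf yx].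
  by rewrite eq_sym.
rewrite big1 // => y py; apply/negbTE/eqP => xy.
by rewrite xy py in npx.
Qed.

Lemma odd_count_mem (y : T) (s : seq T) : odd (count_mem y s) -> y \in s.
Proof. by rewrite -has_pred1 has_count; case: (count _ _). Qed.

Lemma parity_existsP C c : parity C c -> exists2 x, x \in C & c x.
Proof.
move=> h; apply/exists_inP; apply: contraLR h => /exists_inPn h.
by rewrite /parity big1 // => x xC; apply/negbTE/h.
Qed.

(** Pigeonhole: [E] has more subsets than there are vectors of parities, so two subsets share all
    parities. Their symmetric difference is a nonzero solution of the [#|I|] linear equations. *)
Lemma exists_even_subset (I : finType) (E : {set T}) (c : I -> T -> bool) :
  (#|I| < #|E|)%N ->
  exists C, [/\ C \subset E, C != set0 & forall i, parity C (c i) = false].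
Proof.
move=> ltIE; pose f C : {ffun I -> bool} := [ffun i => parity C (c i)].
have: ~~ dinjectiveb f (powerset E).
  apply/negP => /dinjectiveP/leq_card_in.
  rewrite card_powerset card_ffun card_bool leqNgt ltn_exp2l //.
  by rewrite ltIE.
move=> /dinjectivePn[C1]; rewrite powersetE => C1E [C2].
rewrite !inE => /andP[C21 C2E] eqf; exists (symdiff C1 C2); split.
- apply/subsetP => x; rewrite inE.
  by have := subsetP C1E x; have := subsetP C2E x;
    case: (x \in C1); case: (x \in C2) => // h1 h2 _; auto.
- apply: contraNneq C21 => C0; apply/eqP/setP => x.
  by have /setP/(_ x) := C0; rewrite !inE; case: (x \in C1); case: (x \in C2).
- move=> i; rewrite parity_symdiff.
  by have /ffunP/(_ i) := eqf; rewrite !ffunE => ->; rewrite addbb.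
Qed.

End Parity.

Section Cuts.
Variable T : finType.
Implicit Types (A : {set T}) (e : {set T}) (C : {set {set T}}).

(** The parity of the size of [e :&: A], a form that is linear; for an edge it tells whether exactly
    one end lies in [A]. *)
Definition crosses A e : bool := \big[addb/false]_(x in e) (x \in A).

Lemma crosses_set2 A x y : x != y ->
  crosses A [set x; y]%SET = (x \in A) (+) (y \in A).
Proof. by move=> xy; rewrite /crosses big_setU1 ?inE //= big_set1. Qed.

Definition even_edges C := forall x, parity C (fun e => x \in e) = false.

(** Exchanging the sums counts, for each vertex of [A], the members of [C] at it, and each of these
    numbers is even. *)
Lemma parity_crosses A C : even_edges C -> parity C (crosses A) = false.
Proof.
move=> evC; rewrite /parity /crosses.
under eq_bigr do rewrite big_mkcond.
rewrite exchange_big big1 //= => x _; have [xA|_] := boolP (x \in A).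
  by apply: etrans (evC x); apply: eq_bigr => e _; case: ifP.
by rewrite big1 // => e _; case: ifP.
Qed.

End Cuts.

Section CycleSpace.
Variable T : finType.
Implicit Types (C E : {set {set T}}).

(** Two positions of a cycle give the same edge only if [next] swaps them, which a length above 2
    excludes. *)
Lemma next_inj2 (c : seq T) : uniq c -> (2 < size c)%N ->
  {in c, forall x, x != next c x} /\
  {in c &, injective (fun x => [set x; next c x]%SET)}.
Proof.
move=> uc sc.
have nn x : x \in c -> x != next c x /\ next c (next c x) != x.
  move=> /rot_to[i s def_s].
  have us : uniq (x :: s) by rewrite -def_s rot_uniq.
  have : (2 < size (x :: s))%N by rewrite -def_s size_rot.
  rewrite -!(next_rot i uc) def_s; case: s us {def_s} => [|y [|z s]] //= us _.
  rewrite eqxx; move: us; rewrite !inE !negb_or.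
  case/and3P=> /and3P[xy xz xs] _ _; split => //.
  by rewrite [y == x]eq_sym (negPf xy) eqxx eq_sym.
split=> [x /nn[]//|x y xc yc /= eqxy].
have : x \in [set y; next c y]%SET by rewrite -eqxy !inE eqxx.
rewrite !inE => /orP[/eqP//|/eqP xny].
have : y \in [set x; next c x]%SET by rewrite eqxy !inE eqxx.
rewrite !inE => /orP[/eqP//|/eqP ynx].
by have [_ /eqP[]] := nn x xc; rewrite -ynx -xny.
Qed.

Lemma cycle_edges_even (c : seq T) :
  uniq c -> (2 < size c)%N -> even_edges (cycle_edges c).
Proof.
move=> uc sc x; have [neq inj] := next_inj2 uc sc.
rewrite /parity /cycle_edges big_imset //=.
have xE y : y \in c -> (x \in [set y; next c y]%SET) = (x == y) (+) (x == next c y).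
  move=> /neq/eqP yn; rewrite !inE.
  by case: eqP => [->|_]; case: eqP => // /yn.
rewrite (eq_bigr (fun y => (x == y) (+) (x == next c y))) ?big_split /=; last exact: xE.
have pick1 (z : T) : z \in c -> \big[addb/false]_(y in c) (y == z).
  move=> zc; rewrite (bigD1 z) //= eqxx big1 // => y /andP[_ /negPf->] //.
have [xc|xnc] := boolP (x \in c).
  rewrite (eq_bigr (fun y => y == x)) => [|y _]; last by rewrite eq_sym.
  rewrite pick1 // (eq_bigr (fun y => y == prev c x)) ?pick1 ?mem_prev //.
  move=> y yc; apply/eqP/eqP => [->|->]; first by rewrite prev_next.
  by rewrite next_prev.
rewrite !big1 // => y yc; apply/negbTE/eqP => xy; move: xnc;
  by rewrite xy ?mem_next yc.
Qed.

Lemma even_edges_symdiff C1 C2 :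
  even_edges C1 -> even_edges C2 -> even_edges (symdiff C1 C2).
Proof. by move=> ev1 ev2 x; rewrite parity_symdiff ev1 ev2. Qed.

Definition proper_edges C :=
  forall e, e \in C -> exists x y, x != y /\ e = [set x; y].

(** An edge [e] of an even set is never a bridge of that set: its ends stay connected without it,
    and a simple path between them closes up with [e] to a cycle. *)
Lemma even_edges_cycle C : proper_edges C -> even_edges C -> C != set0 ->
  exists c, [/\ simple_cycle (fun u v => [set u; v] \in C) c,
    cycle_edges c \subset C & cycle_edges c != set0].
Proof.
move=> prC evC /set0Pn[e eC]; have [u [v [uv def_e]]] := prC e eC.
pose r := [rel a b | ([set a; b] \in C) && ([set a; b] != e)].
have rsym : symmetric r by move=> a b; rewrite /= setUC.
pose A := [set w | connect r u w].
(* Otherwise [e] would be the only edge of [C] that crosses the component [A] of [u] in [C] minus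
   [e], against [parity_crosses]. *)
have vA : v \in A.
  apply/negPn/negP => vA; have := parity_crosses A evC.
  rewrite /parity (bigD1 e) //= def_e crosses_set2 // (negPf vA) inE connect0.
  rewrite big1 // => e' /andP[e'C e'e]; have [a [b [ab def_e']]] := prC e' e'C.
  rewrite def_e' crosses_set2 // !inE.
  have rab : r a b by rewrite /= -def_e' e'C def_e.
  have -> : connect r u a = connect r u b; last by rewrite addbb.
  by apply: (same_connect_r (sym_connect_sym rsym)); apply: connect1.
move: vA; rewrite inE => /connectP[p0 rp0 lp0].
case/shortenP: rp0 lp0 => p rp up _ lp.
(* A path with a single step would be [e] itself, which [r] excludes. *)
have szp : (1 < size p)%N.
  case: p rp up lp => [|w [|w' p]] //= rp _ lp; first by rewrite lp eqxx in uv.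
  by move: rp; rewrite -lp -def_e eqxx !andbF.
have cyc : path.cycle (fun u v => [set u; v] \in C) (u :: p).
  rewrite /= rcons_path -lp setUC -def_e eC andbT.
  by apply: sub_path rp => a b /andP[].
exists (u :: p); split.
- by rewrite /simple_cycle ltnS szp up.
- apply/subsetP => _ /imsetP[x xp ->].
  exact: (next_cycle cyc).
- apply/set0Pn; exists [set u; next (u :: p) u].
  by apply: imset_f; rewrite inE eqxx.
Qed.

(** Simple cycles span the even sets: induction on [#|C|], splitting off the cycle that
    [even_edges_cycle] provides. *)
Lemma even_edges_ind (E : {set {set T}}) (P : {set {set T}} -> Prop) :
  proper_edges E ->
  P set0 ->
  (forall C c, C \subset E -> simple_cycle (fun u v => [set u; v] \in E) c ->
     P C -> P (symdiff (cycle_edges c) C)) ->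
  forall C, C \subset E -> even_edges C -> P C.
Proof.
move=> prE P0 PS C; have [n] := ubnP #|C|; elim: n C => // n IHn C ltCn CE evC.
have [->//|Cn0] := eqVneq C set0.
have prC : proper_edges C by move=> e eC; apply: prE; apply: (subsetP CE).
have [c [sc cC cn0]] := even_edges_cycle prC evC Cn0.
have -> : C = symdiff (cycle_edges c) (C :\: cycle_edges c).
  apply/setP => e; rewrite !inE; have := subsetP cC e.
  by case: (e \in cycle_edges c) => // /(_ isT) ->.
apply: PS.
- exact: subset_trans (subsetDl _ _) CE.
- case/and3P: sc => s1 s2 s3; apply/and3P; split=> //.
  by apply: sub_cycle s3 => a b /(subsetP CE).
apply: IHn; last 2 first.
- exact: subset_trans (subsetDl _ _) CE.
- have -> : C :\: cycle_edges c = symdiff C (cycle_edges c).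
    apply/setP => e; rewrite !inE; have := subsetP cC e.
    by case: (e \in cycle_edges c) => [/(_ isT)->|] //; case: (e \in C).
  apply: even_edges_symdiff => //; case/and3P: sc => s1 s2 _.
  exact: cycle_edges_even.
rewrite -ltnS; apply: leq_trans ltCn; rewrite ltnS; apply: proper_card.
have [e ec] := set0Pn _ cn0; rewrite properE subsetDl; apply/subsetPn; exists e.
  exact: (subsetP cC).
by rewrite !inE ec.
Qed.

End CycleSpace.

(** * Removable edges in the union of the lifted walks *)

Section CutEdges.
Variables (V X : finType) (E : {set {set V}}) (f : V -> X).
Variables (W : {set V} -> seq {set X}) (pr : {set X} -> {set V}).
Hypothesis Eproper : proper_edges E.
Hypothesis W_crosses : forall (A : {set X}) u v, [set u; v] \in E ->
  odd (count (crosses A) (W [set u; v])) = (f u \in A) (+) (f v \in A).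
Hypothesis W_cycle : forall c e,
  simple_cycle (fun u v => [set u; v] \in E) c -> e \in E ->
  parity (cycle_edges c) (fun e' => odd (count (fun y => pr y == e) (W e')))
    = (e \in cycle_edges c).

(** Both sides are additive under symmetric difference, so the case of simple cycles, [W_cycle],
    suffices. *)
Lemma even_edges_lift (C : {set {set V}}) (e : {set V}) : C \subset E -> even_edges C -> e \in E ->
  parity C (fun e' => odd (count (fun y => pr y == e) (W e'))) = (e \in C).
Proof.
move=> CE evC eE; pattern C; apply: even_edges_ind C CE evC => //.
  by rewrite /parity big_set0 inE.
by move=> C c CE sc IHC; rewrite parity_symdiff IHC W_cycle // inE.
Qed.

(** The walk over [[set u; v]] crosses [A] an odd number of times exactly when [f] separates its
    ends, so the sum is the parity of [C] on the cut given by the preimage of [A]. *)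
Lemma even_edges_lift_crosses (C : {set {set V}}) (A : {set X}) : C \subset E -> even_edges C ->
  parity C (fun e => odd (count (crosses A) (W e))) = false.
Proof.
move=> CE evC; rewrite -(parity_crosses (f @^-1: A) evC).
apply: eq_bigr => e /(subsetP CE) eE; have [u [v [uv def_e]]] := Eproper eE.
by rewrite def_e W_crosses ?crosses_set2 ?inE // -def_e.
Qed.

(* Each new edge [y] is found on the lift of a nonzero even set [C] that avoids
   the edges already chosen, upstairs as well as downstairs; the rest of that
   lift reconnects the two ends of [y]. *)
Lemma exists_cut_edges k : (#|V| + k.*2 <= #|E|)%N ->
  exists F : seq {set X}, [/\ size F = k, uniq (map pr F),
    forall y, y \in F -> pr y \in E /\ exists2 e, e \in E & y \in W e &
    forall A : {set X},
      (forall e y, e \in E -> y \in W e -> y \notin F -> ~~ crosses A y) ->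
      forall e y, e \in E -> y \in W e -> ~~ crosses A y].
Proof.
elim: k => [_|k IHk].
  by exists [::]; split => // A h e y eE yW; apply: h eE yW _.
rewrite doubleS !addnS => lek; have [|F [szF uF FW Fcut]] := IHk.
  by apply: leq_trans lek; rewrite ltnW.
(* The linear conditions on [C]: evenness at each vertex, and for each of the [k] edges already in
   [F], an even multiplicity in the lift of [C] and absence of its projection from [C]. This is
   where [#|V| + k.*2] comes from. *)
pose I : finType := (V + ('I_k + 'I_k))%type.
pose c (i : I) (e : {set V}) : bool := match i with
  | inl x => x \in e
  | inr (inl j) => odd (count_mem (nth set0 F j) (W e))
  | inr (inr j) => e == pr (nth set0 F j)
  end.
have [|C [CE Cn0 Cc]] := @exists_even_subset _ I E c.
  by rewrite !card_sum !card_ord addnn; apply: leq_trans lek; rewrite ltnS leqW.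
have evC : even_edges C by move=> x; apply: (Cc (inl x)).
have CF y : y \in F -> parity C (fun e => odd (count_mem y (W e))) = false.
  move=> yF; have ltyk : (index y F < k)%N by rewrite -szF index_mem.
  by have := Cc (inr (inl (Ordinal ltyk))); rewrite /c /= nth_index.
have CprF y : y \in F -> pr y \notin C.
  move=> yF; have ltyk : (index y F < k)%N by rewrite -szF index_mem.
  have := Cc (inr (inr (Ordinal ltyk))); rewrite /c /= nth_index // => h.
  apply/negP => yC; move: h; rewrite /parity (bigD1 (pr y)) //= eqxx big1 //.
  by move=> e /andP[_ /negPf].
have [e eC] := set0Pn _ Cn0; have eE := subsetP CE e eC.
have := even_edges_lift CE evC eE; rewrite eC.
rewrite /parity (eq_bigr _ (fun e' _ => odd_count_xor (fun y => pr y == e) (W e'))).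
rewrite exchange_big /= => h.
(* The edges above [e] occur an odd number of times altogether in the lift of [C], so one of them
   does. *)
have {h}[y /eqP pry yC] : exists2 y, pr y == e &
    parity C (fun e => odd (count_mem y (W e))).
  apply/exists_inP; apply: contraTT h => /exists_inPn h.
  by rewrite big1 // => y /h/negbTE.
exists (y :: F); split=> /=; first by rewrite szF.
- rewrite uF andbT; apply/mapP => -[y' y'F eqpr].
  by have := CprF y' y'F; rewrite -eqpr pry eC.
- move=> y'; rewrite inE => /predU1P[->|/FW //]; rewrite pry; split=> //.
  have [e' e'C /odd_count_mem yW] := parity_existsP yC.
  by exists e' => //; apply: (subsetP CE).
move=> A hA; apply: Fcut => e' y' e'E y'W y'F.
have [y'y|y'y] := eqVneq y' y; last by apply: hA e'E y'W _; rewrite inE negb_or y'y.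
(* If [y] crossed [A], it would be the only crossing edge with odd multiplicity in the lift of [C]:
   those in [F] have even multiplicity, and the other edges of the lift do not cross. *)
rewrite y'y; apply/negP => crA; have := even_edges_lift_crosses A CE evC.
rewrite /parity (eq_bigr _ (fun e' _ => odd_count_xor (crosses A) (W e'))).
rewrite exchange_big /= (bigD1 y) //= -/(parity _ _) yC.
rewrite big1 // => z /andP[crz zy].
have [/CF//|zF] := boolP (z \in F).
rewrite big1 // => e2 /(subsetP CE) e2E; apply/negbTE; apply/negP => /odd_count_mem zW.
by move: zW => /(hA _ _ e2E); rewrite inE negb_or zy zF crz => /(_ isT).
Qed.

End CutEdges.

(** * Switching and tours *)

Section Switching.
Variables (I H : finType) (T : Type) (tr : {ffun I -> {perm H}} -> T).
Variables (D : T -> {set I * H}) (src tgt : T -> I -> H) (S : {set I}) (K : nat).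
Variable B : {set {ffun I -> {perm H}}}.
Hypothesis tr_local : forall m m' : {ffun I -> {perm H}},
  (forall e h, (e, h) \in D (tr m) -> m' e h = m e h) -> tr m' = tr m.
Hypothesis B_src : forall m e, m \in B -> e \in S -> m e (src (tr m) e) = tgt (tr m) e.
Hypothesis B_new : forall m e, m \in B -> e \in S -> (e, src (tr m) e) \notin D (tr m).
Hypothesis B_small : forall m e, m \in B -> e \in S ->
  #|[set h | (e, h) \in D (tr m)]| <= K.

(* Swapping the forced value [tgt] of [m e] for any value that the trace has
   not looked up leaves the trace unchanged. *)
Lemma card_switching : #|B| * (#|H| - K) ^ #|S| <= #|{ffun I -> {perm H}}|.
Proof.
set q := #|H| - K.
pose DH t e := [set h | (e, h) \in D t].
pose free (m : {ffun I -> {perm H}}) e := enum (~: (m e @: DH (tr m) e)).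
have sz_free m e : m \in B -> e \in S -> q <= size (free m e).
  move=> mB eS; rewrite -cardE cardsCs setCK leq_sub2l //.
  rewrite card_imset; last exact: perm_inj.
  exact: B_small.
pose J := {e : I | e \in S}.
pose z (m : {ffun I -> {perm H}}) (c : {ffun J -> 'I_q}) (j : J) :=
  nth (tgt (tr m) (val j)) (free m (val j)) (c j).
have z_free m c j : m \in B -> z m c j \in ~: (m (val j) @: DH (tr m) (val j)).
  move=> mB; rewrite -mem_enum; apply: mem_nth.
  by apply: leq_trans (ltn_ord _) _; apply: sz_free mB (valP j).
pose phi (p : {ffun I -> {perm H}} * {ffun J -> 'I_q}) : {ffun I -> {perm H}} :=
  [ffun e => (p.1 e * if insub e is Some j
     then tperm (tgt (tr p.1) e) (z p.1 p.2 j) else 1)%g].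
have phiS m c (j : J) :
    phi (m, c) (val j) = (m (val j) * tperm (tgt (tr m) (val j)) (z m c j))%g.
  by rewrite ffunE /= valK.
have phiD m c e h : m \in B -> (e, h) \in D (tr m) -> phi (m, c) e h = m e h.
  move=> mB ehD; rewrite ffunE /= permM; case: insubP => [j eS je|_]; last first.
    by rewrite perm1.
  rewrite tpermD //.
    rewrite -(B_src mB eS) (inj_eq perm_inj); apply: contraNneq (B_new mB eS).
    by move=> ->.
  have := z_free m c j mB; rewrite -je inE; apply: contraNneq => ->.
  by apply: imset_f; rewrite inE je.
have tr_phi m c : m \in B -> tr (phi (m, c)) = tr m.
  by move=> mB; apply: tr_local => e h; apply: phiD.
(* The image has the same trace as [m], which determines the free values. Its value at [src] then
   gives back the indices [c], and cancelling the transpositions gives back [m]. *)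
have phi_inj : {in setX B setT &, injective phi}.
  move=> [m1 c1] [m2 c2]; rewrite !inE !andbT /= => m1B m2B eqphi.
  have eqtr : tr m1 = tr m2 by rewrite -(tr_phi m1 c1) // eqphi tr_phi.
  have eqDm e h : (e, h) \in D (tr m1) -> m1 e h = m2 e h.
    by move=> hD; rewrite -(phiD m1 c1) // eqphi phiD // -eqtr.
  have eqfree e : free m1 e = free m2 e.
    congr (enum (mem (~: _))); rewrite -eqtr; apply: eq_in_imset => h.
    by rewrite inE; apply: eqDm.
  have phi_src m c j : m \in B ->
      phi (m, c) (val j) (src (tr m) (val j)) = z m c j.
    by move=> mB; rewrite phiS permM (B_src mB (valP j)) tpermL.
  have eqz j : z m1 c1 j = z m2 c2 j.
    by rewrite -!phi_src // eqphi eqtr.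
  have eqc : c1 = c2.
    apply/ffunP => j; apply: val_inj; apply/eqP.
    rewrite -(@nth_uniq _ (tgt (tr m1) (val j)) (free m1 (val j))) ?enum_uniq //.
    - by have := eqz j; rewrite /z -eqfree -eqtr => ->.
    - by apply: leq_trans (ltn_ord _) _; apply: sz_free m1B (valP j).
    - by apply: leq_trans (ltn_ord _) _; apply: sz_free m1B (valP j).
  congr (_, _) => //; apply/ffunP => e.
  have /ffunP/(_ e) := eqphi; rewrite !ffunE /= -eqtr.
  by case: insubP => [j _ _|_]; rewrite ?eqz => /mulIg.
move/leq_card_in: phi_inj.
by rewrite cardsX cardsT [#|{ffun J -> _}|]card_ffun card_ord card_sig.
Qed.

End Switching.

(** * Tours of a graph written as words *)

Section Tours.
Variables (X L : finType).

(** [None] pauses, [Some None] jumps to the next root. *)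
Definition letter := option (option L).

Section Decode.
Variable step : X -> L -> X.

(** [rs] lists the roots still to be jumped to; once it is empty, a jump stays in place. *)
Fixpoint visits (x : X) (rs : seq X) (w : seq letter) : seq X :=
  x :: match w with
  | [::] => [::]
  | None :: w' => visits x rs w'
  | Some None :: w' => visits (head x rs) (behead rs) w'
  | Some (Some l) :: w' => visits (step x l) rs w'
  end.

(** Jumps and pauses are left out since they do not consult [step]. *)
Fixpoint moves (x : X) (rs : seq X) (w : seq letter) : seq (X * L * X) :=
  match w with
  | [::] => [::]
  | None :: w' => moves x rs w'
  | Some None :: w' => moves (head x rs) (behead rs) w'
  | Some (Some l) :: w' => (x, l, step x l) :: moves (step x l) rs w'
  end.

Lemma visits_head x rs w : x \in visits x rs w.
Proof. by case: w => [|[[l|]|] w]; rewrite /= inE eqxx. Qed.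

Lemma moves_step x rs w t : t \in moves x rs w -> t.2 = step t.1.1 t.1.2.
Proof.
elim: w x rs => [|[[l|]|] w IHw] x rs //=; try exact: IHw.
by rewrite inE => /predU1P[->|/IHw].
Qed.

Lemma moves_visits x rs w t : t \in moves x rs w ->
  t.1.1 \in visits x rs w /\ t.2 \in visits x rs w.
Proof.
elim: w x rs => [|[[l|]|] w IHw] x rs //=; rewrite !inE.
- case/predU1P=> [->|/IHw[-> ->]]; last by rewrite !orbT.
  by rewrite eqxx visits_head orbT.
- by move=> /IHw[-> ->]; rewrite !orbT.
- by move=> /IHw[-> ->]; rewrite !orbT.
Qed.

(** At the first visit to [a] the tour goes to [b] and straight back, so that the rest of the word
    is read as before. *)
Lemma insert_detour x rs w a b l l' :
  a \in visits x rs w -> step a l = b -> step b l' = a ->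
  exists w', [/\ size w' = (size w).+2, visits x rs w' =i b :: visits x rs w &
    moves x rs w' =i [:: (a, l, b), (b, l', a) & moves x rs w]].
Proof.
move=> + ab ba; elim: w x rs => [|t w IHw] x rs ax.
  move: ax; rewrite inE => /eqP ax; subst x.
  exists [:: Some (Some l); Some (Some l')]; split=> [//|y|y]; rewrite /= ab ba //.
  by rewrite !inE; case: (y == a); case: (y == b).
have [ax'|ax'] := eqVneq a x.
  subst x; exists [:: Some (Some l), Some (Some l') & t :: w].
  split=> [//|y|y]; rewrite /= ab ba //.
  by rewrite !inE; case: (y == a); case: (y == b).
case: t ax => [[l0|]|] /=; rewrite inE (negPf ax') /= => /IHw[w' [sz vw mw]].
- exists (Some (Some l0) :: w'); split=> [|y|y] /=; first by rewrite sz.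
    by rewrite inE vw !inE; case: (y == x); rewrite ?orbT.
  by rewrite inE mw !inE; do 3 case: (y == _).
- exists (Some None :: w'); split=> [|y|y] /=; first by rewrite sz.
    by rewrite inE vw !inE; case: (y == x); rewrite ?orbT.
  by rewrite mw.
- exists (None :: w'); split=> [|y|y] /=; first by rewrite sz.
    by rewrite inE vw !inE; case: (y == x); rewrite ?orbT.
  by rewrite mw.
Qed.

(** Pauses bring all words to the same length, so that they are tuples and can be counted. *)
Lemma pad_word x rs w n :
  visits x rs (nseq n None ++ w) =i visits x rs w /\
  moves x rs (nseq n None ++ w) = moves x rs w.
Proof.
elim: n => [|n [IHv IHm]]; first by split.
split=> [y|]; last by rewrite /= IHm.
by rewrite inE IHv orb_idl // => /eqP->; apply: visits_head.
Qed.

Lemma jump_word x rs :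
  visits x rs (nseq (size rs) (Some None)) =i x :: rs /\
  moves x rs (nseq (size rs) (Some None)) = [::].
Proof.
elim: rs x => [|r rs IHrs] x //=; have [IHv IHm] := IHrs r.
by split=> // y; rewrite inE IHv.
Qed.

(** The tour first jumps through all roots; then, as long as an [r]-edge leaves the visited set, a
    detour along it is inserted. By the last hypothesis this stops only when [S] is exhausted. *)
Lemma exists_tour (r : rel X) (S : {set X}) x rs n :
  size rs + #|S|.*2 <= n ->
  symmetric r ->
  (forall a b, r a b -> exists l, step a l = b) ->
  {in S, forall a b, r a b -> b \in S} ->
  {subset x :: rs <= S} ->
  (forall A : {set X}, {subset x :: rs <= A} ->
     {in A, forall a b, r a b -> b \in A} -> S \subset A) ->
  exists w, [/\ size w = n, visits x rs w =i S &
    forall t, t \in moves x rs w -> r t.1.1 t.2].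
Proof.
move=> len rsym rstep rS rootS conn.
suff [w [szw vw mw]] : exists w, [/\ size w <= size rs + #|S|.*2,
    visits x rs w =i S & forall t, t \in moves x rs w -> r t.1.1 t.2].
  exists (nseq (n - size w) None ++ w).
  have [pv pm] := pad_word x rs w (n - size w).
  split; first by rewrite size_cat size_nseq subnK // (leq_trans szw).
    by move=> y; rewrite pv vw.
  by rewrite pm.
(* A detour costs two letters and visits at least one new point, so the length plus twice the number
   of unvisited points never grows. *)
have ext w : {subset visits x rs w <= S} -> {subset x :: rs <= visits x rs w} ->
    (forall t, t \in moves x rs w -> r t.1.1 t.2) ->
    size w + #|S :\: [set y in visits x rs w]|.*2 <= size rs + #|S|.*2 ->
    exists w', [/\ size w' <= size rs + #|S|.*2,
      visits x rs w' =i S & forall t, t \in moves x rs w' -> r t.1.1 t.2].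
  have [j] := ubnP #|S :\: [set y in visits x rs w]|.
  elim: j w => // j IHj w ltj vS rv mr szw.
  have [Sv|] := boolP (S \subset [set y in visits x rs w]).
    exists w; split=> //; first by apply: leq_trans (leq_addr _ _) szw.
    move=> y; apply/idP/idP => [/vS//|yS].
    by have := subsetP Sv y yS; rewrite inE.
  move=> nSv; have [/exists_inP[a av /exists_inP[b rab bv]]|/exists_inPn h] :=
      boolP [exists a in visits x rs w, exists b in r a, b \notin visits x rs w];
    last first.
    case/negP: nSv; apply: conn => [y /rv|a]; first by rewrite inE.
    rewrite inE => /h/exists_inPn hb b rab.
    by rewrite inE; apply/negbNE/hb.
  have aS : a \in S by apply: vS.
  have [l ab] := rstep a b rab; have [l' ba] := rstep b a (etrans (rsym _ _) rab).
  have [w' [sz' v' m']] := insert_detour av ab ba.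
  have bS : b \in S := rS a aS b rab.
  have ltD : #|S :\: [set y in visits x rs w']| < #|S :\: [set y in visits x rs w]|.
    apply: proper_card; apply/properP; split.
      apply/subsetP => y; rewrite !inE v' inE negb_or => /andP[/andP[_ ->] ->] //.
    by exists b; rewrite !inE ?bv ?bS // v' inE eqxx.
  apply: (IHj w').
  - by apply: leq_trans ltD _; rewrite -ltnS.
  - by move=> y; rewrite v' inE => /predU1P[->//|/vS].
  - by move=> y /rv; rewrite v' inE => ->; rewrite orbT.
  - move=> t; rewrite m' !inE => /or3P[/eqP->|/eqP->|/mr] //=.
    by rewrite rsym.
  apply: leq_trans szw; rewrite sz' -addn2 -addnA leq_add2l.
  by rewrite -[2]/(1.*2) -doubleD leq_double add1n.
have [jv jm] := jump_word x rs; apply: ext (nseq (size rs) (Some None)) _ _ _ _.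
- by move=> y; rewrite jv => /rootS.
- by move=> y; rewrite jv.
- by rewrite jm.
- by rewrite size_nseq leq_add2l leq_double subset_leq_card // subsetDl.
Qed.

End Decode.

(** Decoding consults the step function only at the recorded moves. This is the locality of the
    trace that switching requires. *)
Lemma eq_decode (step step' : X -> L -> X) x rs w :
  (forall t, t \in moves step x rs w -> step' t.1.1 t.1.2 = t.2) ->
  visits step' x rs w = visits step x rs w /\
  moves step' x rs w = moves step x rs w.
Proof.
elim: w x rs => [|[[l|]|] w IHw] x rs //= h; last 2 first.
- by have [-> ->] := IHw _ _ h.
- by have [-> ->] := IHw _ _ h.
have -> : step' x l = step x l by apply: (h (x, l, step x l)); rewrite inE eqxx.
have [|-> ->] // := IHw (step x l) rs.
by move=> t tm; apply: h; rewrite inE tm orbT.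
Qed.

End Tours.

(** * Codes *)

(** Union bound: each [q] covers at most a fraction [1 / b] of [M], and there are fewer than [b] of
    them. *)
Lemma exists_uncovered (M Q : finType) (P : Q -> pred M) (b : nat) :
  0 < #|M| -> (forall q, #|[set m | P q m]| * b <= #|M|) -> #|Q| < b ->
  exists m, forall q, ~~ P q m.
Proof.
move=> M0 leP ltQ.
suff /existsP[m /forallP] : [exists m, [forall q, ~~ P q m]] by exists m.
apply: contraT => /existsPn h.
have cover : #|M| <= \sum_(q : Q) #|[set m | P q m]|.
  rewrite -sum1_card; under [X in _ <= X]eq_bigr do rewrite -sum1_card.
  rewrite (exchange_big_dep predT) //=; apply: leq_sum => m _.
  by have /forallPn[q /negbNE qm] := h m; rewrite (bigD1 q) ?inE.
have := leq_mul cover (leqnn b); rewrite big_distrl /=.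
apply: contraTT => _; rewrite -ltnNge.
apply: (@leq_ltn_trans (\sum_(q : Q) #|M|)); first exact: leq_sum.
by rewrite sum_nat_const mulnC ltn_pmul2l.
Qed.

(** * Exploring the extension and encoding its matchings *)

Section Exploration.
Variables (d : nat) (G H : sgraph).
Local Notation X := (G * H)%type.
Local Notation label := ('I_d + 'I_d)%type.
Hypothesis degG : forall x : G, #|sedge x| <= d.
Hypothesis degH : forall x : H, #|sedge x| <= d.

Definition neighbour (K : sgraph) (x : K) (i : nat) : K := nth x (enum (sedge x)) i.

Lemma neighbourP (K : sgraph) (x y : K) : #|sedge x| <= d -> sedge x y ->
  exists i : 'I_d, neighbour x i = y.
Proof.
move=> led xy; have yx : y \in enum (sedge x) by rewrite mem_enum.
have lti : index y (enum (sedge x)) < d.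
  by apply: leq_trans led; rewrite cardE index_mem.
by exists (Ordinal lti); rewrite /neighbour nth_index.
Qed.

(** A matching is stored for one orientation of its edge and is inverted for the other; the last
    case is a default for pairs that are not edges. *)
Definition follow (m : matchings G H) (g g' : G) (h : H) : H :=
  if (insub (g, g') : option (oriented_edge G)) is Some e then m e h
  else if (insub (g', g) : option (oriented_edge G)) is Some e then (m e)^-1%g h
  else h.

Definition ext_step (m : matchings G H) (x : X) (l : label) : X :=
  match l with
  | inl i => (x.1, neighbour x.2 i)
  | inr i => (neighbour x.1 i, follow m x.1 (neighbour x.1 i) x.2)
  end.

Lemma insub_oriented (e : oriented_edge G) :
  insub ((val e).2, (val e).1) = None :> option (oriented_edge G).
Proof.
apply: insubF => /=; have /andP[_ lt12] := valP e.
by rewrite [(enum_rank _ < _)%N]ltnNge (ltnW lt12) andbF.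
Qed.

Lemma ext_stepP m (x y : ext_graph m) : sedge x y -> exists l, ext_step m x l = y.
Proof.
case: x y => [x1 x2] [y1 y2] /orP[/andP[/= /eqP <- xy]|].
  by have [i <-] := neighbourP (degH x2) xy; exists (inl i).
case/existsP=> e /= /orP[] /andP[/eqP ve /eqP me].
  have /andP[/= xy _] := valP e; rewrite ve /= in xy.
  have [i def_y] := neighbourP (degG x1) xy; exists (inr i).
  by rewrite /= def_y /follow -ve valK me.
have /andP[/= xy _] := valP e; rewrite ve /= sedge_sym in xy.
have [i def_y] := neighbourP (degG x1) xy; exists (inr i).
have := insub_oriented e; rewrite /= def_y /follow ve /= => ->.
by rewrite -ve valK -me permK.
Qed.

(** The entry of the matchings that a move reveals. It is always indexed by the point in the first
    cloud of [e], so a backward move is recorded by its arrival. *)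
Definition lookup (t : X * label * X) : option (oriented_edge G * H) :=
  if t.1.2 is inl _ then None else
  if (insub (t.1.1.1, t.2.1) : option (oriented_edge G)) is Some e
  then Some (e, t.1.1.2) else
  if (insub (t.2.1, t.1.1.1) : option (oriented_edge G)) is Some e
  then Some (e, t.2.2) else None.

Lemma lookupP m t e h : t.2 = ext_step m t.1.1 t.1.2 -> lookup t = Some (e, h) ->
  (t.1.1 = ((val e).1, h) /\ t.2 = ((val e).2, m e h)) \/
  (t.1.1 = ((val e).2, m e h) /\ t.2 = ((val e).1, h)).
Proof.
case: t => [[[x1 x2] [i|i]] [y1 y2]] //=; rewrite /lookup /= => -[-> ->].
rewrite /follow; case: insubP => [e' _ ve'|_].
  by move=> [<- <-]; left; rewrite ve'.
case: insubP => [e' _ ve'|_] //.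
by move=> [<- <-]; right; rewrite ve' permKV.
Qed.

(** A backward move applies the inverse permutation, but agreement at the arrival point is enough,
    by injectivity. *)
Lemma lookup_local (m m' : matchings G H) t : t.2 = ext_step m t.1.1 t.1.2 ->
  (forall e h, lookup t = Some (e, h) -> m' e h = m e h) ->
  ext_step m' t.1.1 t.1.2 = t.2.
Proof.
case: t => [[[x1 x2] [i|i]] [y1 y2]] //=; rewrite /lookup /= => -[-> ->].
rewrite /follow; case: insubP => [e _ ve|_] h; first by rewrite h.
congr pair; case: insubP h => [e _ ve|_] // h.
by apply: (@perm_inj _ (m' e)); rewrite permKV h // permKV.
Qed.

Definition looked_up (ts : seq (X * label * X)) : {set oriented_edge G * H} :=
  [set p | Some p \in map lookup ts].

Definition cloud (vs : seq X) (g : G) : {set H} := [set h | (g, h) \in vs].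

Variables (h0 : H) (c B K k : nat).

(** A start, the roots, a word, and for some edges of [G] a matching edge above them, given by the
    ranks of its two ends among the visited points of their clouds. *)
Definition ext_code : finType :=
  (X * c.-tuple X * B.-tuple (letter label)
     * {ffun oriented_edge G -> option ('I_K * 'I_K)})%type.

Definition pick (vs : seq X) (g : G) (i : nat) : H := nth h0 (enum (cloud vs g)) i.

Definition code_visits (q : ext_code) m := visits (ext_step m) q.1.1.1 q.1.1.2 q.1.2.
Definition code_moves (q : ext_code) m := moves (ext_step m) q.1.1.1 q.1.1.2 q.1.2.

(** These are the demands of switching: enough named edges, few values looked up in each matching,
    and named edges that are right for [m] but not looked up by the tour. *)
Definition encodes (q : ext_code) (m : matchings G H) : bool :=
  [&& k <= #|[set e | isSome (q.2 e)]|,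
      [forall e, #|[set h | (e, h) \in looked_up (code_moves q m)]| <= K] &
      [forall e, if q.2 e is Some (i, j) then
         let h := pick (code_visits q m) (val e).1 i in
         (m e h == pick (code_visits q m) (val e).2 j)
           && ((e, h) \notin looked_up (code_moves q m))
       else true]].

(** For a fixed code, the trace formed by the visits and the moves determines both ends of every
    named edge, so [card_switching] applies. *)
Lemma card_encodes q :
  K < #|H| ->
  #|[set m | encodes q m]| * (#|H| - K) ^ k <= #|{: matchings G H}|.
Proof.
move=> ltK; have [lek|ltk] := leqP k #|[set e | isSome (q.2 e)]|; last first.
  rewrite (_ : [set m | _] = set0) ?cards0 //.
  by apply/setP => m; rewrite !inE /encodes leqNgt ltk.
have BE m : m \in [set m | encodes q m] -> encodes q m by rewrite inE.
pose tr m := (code_visits q m, code_moves q m).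
pose ix (b : bool) (t : seq X * seq (X * label * X)) e : H :=
  if q.2 e is Some (i, j) then
    if b then pick t.1 (val e).1 i else pick t.1 (val e).2 j
  else h0.
apply: leq_trans _ (@card_switching _ _ _ tr (fun t => looked_up t.2)
  (ix true) (ix false) [set e | isSome (q.2 e)] K [set m | encodes q m] _ _ _ _).
- by rewrite leq_mul2l leq_pexp2l ?orbT // subn_gt0.
- move=> m m' h; have [|hv hm] := @eq_decode _ _ (ext_step m) (ext_step m')
      q.1.1.1 q.1.1.2 q.1.2; last by rewrite /tr /code_visits /code_moves hv hm.
  move=> t tm; apply: lookup_local (moves_step tm) _ => e h' def_p.
  by apply: h; rewrite inE -def_p map_f.
- move=> m e /BE/and3P[_ _ /forallP/(_ e)]; rewrite inE /ix.
  by case: (q.2 e) => [[i j]|] //= /andP[/eqP].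
- move=> m e /BE/and3P[_ _ /forallP/(_ e)]; rewrite [e \in _]inE /ix.
  by case: (q.2 e) => [[i j]|] //= /andP[_].
- by move=> m e /BE/and3P[_ /forallP/(_ e)].
Qed.

Lemma exists_not_encoded :
  K < #|H| ->
  (#|G| * #|H|) ^ c.+1 * (d.*2.+2) ^ B * (K ^ 2).+1 ^ #|{: oriented_edge G}|
    < (#|H| - K) ^ k ->
  exists m, forall q, ~~ encodes q m.
Proof.
move=> ltK lt_codes.
have card_code : #|{: ext_code}| =
    (#|G| * #|H|) ^ c.+1 * (d.*2.+2) ^ B * (K ^ 2).+1 ^ #|{: oriented_edge G}|.
  rewrite !card_prod !card_tuple card_prod expnS !card_option card_sum card_ord.
  by rewrite card_ffun card_option card_prod card_ord addnn mulnn.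
apply: (@exists_uncovered _ _ encodes ((#|H| - K) ^ k)); last by rewrite card_code.
  by apply/card_gt0P; exists [ffun => 1%g].
by move=> q; apply: card_encodes.
Qed.

(** The tour visits exactly [S], so ranks within clouds stay below [K]; it moves only along [r], so
    it never looks up an edge named by [F]. *)
Lemma exists_code m (r : rel X) (S : {set X}) x (rs : c.-tuple X)
    (F : oriented_edge G -> option H) :
  c + #|S|.*2 <= B ->
  symmetric r ->
  (forall a b, r a b -> @sedge (ext_graph m) a b) ->
  {in S, forall a b, r a b -> b \in S} ->
  {subset x :: rs <= S} ->
  (forall A : {set X}, {subset x :: rs <= A} ->
     {in A, forall a b, r a b -> b \in A} -> S \subset A) ->
  (forall g, #|[set h | (g, h) \in S]| <= K) ->
  k <= #|[set e | isSome (F e)]| ->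
  (forall e h, F e = Some h ->
     [/\ ((val e).1, h) \in S, ((val e).2, m e h) \in S &
        ~~ r ((val e).1, h) ((val e).2, m e h)]) ->
  exists q : ext_code, encodes q m.
Proof.
move=> lenB rsym rext rS rootS conn cloudK kF FS.
have [||w [szw vw mw]] := @exists_tour _ _ (ext_step m) r S x rs B _ rsym _ rS rootS conn.
- by rewrite size_tuple.
- by move=> a b /rext; apply: ext_stepP.
have w_sz : size w == B by rewrite szw.
have cloudS g : cloud (visits (ext_step m) x rs w) g = [set h | (g, h) \in S].
  by apply/setP => h; rewrite !inE vw.
have pickS g h : (g, h) \in S -> exists i : 'I_K,
    pick (visits (ext_step m) x rs w) g i = h.
  move=> ghS; rewrite /pick cloudS; set A := [set h | _].
  have hA : h \in enum A by rewrite mem_enum inE.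
  have lti : index h (enum A) < K.
    by apply: leq_trans (cloudK g); rewrite cardE index_mem.
  by exists (Ordinal lti); rewrite /= nth_index.
have lookedP e h : (e, h) \in looked_up (moves (ext_step m) x rs w) ->
    ((val e).1, h) \in S /\ r ((val e).1, h) ((val e).2, m e h).
  rewrite inE => /mapP[t tm /esym tl]; have := mw t tm.
  have [] := moves_visits tm; rewrite !vw.
  by case: (lookupP (moves_step tm) tl) => -[-> ->] // ? ?; rewrite rsym.
pose q2 e : option ('I_K * 'I_K) := if F e is Some h then
    [pick p : 'I_K * 'I_K | let vs := visits (ext_step m) x rs w in
      (pick vs (val e).1 p.1 == h) && (pick vs (val e).2 p.2 == m e h)]
  else None.
have q2P e : if F e is Some h then exists i j, [/\ q2 e = Some (i, j),
      pick (visits (ext_step m) x rs w) (val e).1 i = h &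
      pick (visits (ext_step m) x rs w) (val e).2 j = m e h]
    else q2 e = None.
  rewrite /q2; case Fe: (F e) => [h|//].
  have [h1S h2S _] := FS e h Fe.
  case: pickP => [[i j] /andP[/eqP ih /eqP jh]|no]; first by exists i, j.
  have [i ih] := pickS _ _ h1S; have [j jh] := pickS _ _ h2S.
  by have := no (i, j); rewrite /= ih jh !eqxx.
exists (x, rs, Tuple w_sz, [ffun e => q2 e]); apply/and3P; split.
- apply: leq_trans kF _; apply: subset_leq_card; apply/subsetP => e.
  by rewrite !inE ffunE /=; have := q2P e; case: (F e) => // h [i [j [-> _ _]]].
- apply/forallP => e; apply: leq_trans (cloudK (val e).1).
  by apply: subset_leq_card; apply/subsetP => h; rewrite inE => /lookedP[]; rewrite inE.
apply/forallP => e; rewrite ffunE /=; have := q2P e.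
case Fe: (F e) => [h|]; last by move=> ->.
move=> [i [j [-> /= ih jh]]].
rewrite /code_visits /code_moves /= ih jh eqxx /=.
by apply/negP => /lookedP[_]; apply/negP; have [] := FS e h Fe.
Qed.

End Exploration.

(** * From splits to codes *)

Section Reach.
Variable G : sgraph.
Implicit Types (x y z : G) (s t : nat).

Definition reach t x y : Prop :=
  exists p, [/\ path (@sedge G) x p, last x p = y & size p <= t].

Lemma reach_sym t x y : reach t x y -> reach t y x.
Proof.
case=> p [pp <- szp]; exists (rev (belast x p)); split.
- by rewrite rev_path (eq_path (e' := @sedge G)) // => a b; apply: sedge_sym.
- by case: p {pp szp} => // a p; rewrite /= rev_cons last_rcons.
- by rewrite size_rev size_belast.
Qed.

Lemma reach_trans s t x y z : reach s x y -> reach t y z -> reach (s + t) x z.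
Proof.
case=> p [pp <- szp] [q [qq <- szq]]; exists (p ++ q); split.
- by rewrite cat_path pp.
- by rewrite last_cat.
- by rewrite size_cat leq_add.
Qed.

Lemma reach_le s t x y : s <= t -> reach s x y -> reach t x y.
Proof. by move=> st [p [pp lp szp]]; exists p; split=> //; apply: leq_trans st. Qed.

Lemma reach_walk x p y : path (@sedge G) x p -> y \in x :: p ->
  reach (size p) x y /\ reach (size p) y (last x p).
Proof.
move=> + yp; case/splitPl: yp => p1 p2 lp1; rewrite cat_path last_cat lp1 size_cat.
by move=> /andP[p1p p2p]; split; [exists p1 | exists p2]; split => //;
  rewrite ?leq_addr ?leq_addl.
Qed.

(** A list with repetitions. Each round also keeps its centre, whence the base [d.+1] in
    [size_ball]. *)
Fixpoint ball t x : seq G :=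
  if t is t'.+1 then flatten [seq ball t' y | y <- x :: enum (sedge x)] else [:: x].

Lemma size_ball d t x : (forall y, #|sedge y| <= d) -> size (ball t x) <= d.+1 ^ t.
Proof.
move=> deg; elim: t x => //= t IHt x.
rewrite size_cat size_flatten /shape -map_comp expnS mulSn leq_add //.
apply: leq_trans (leq_mul (deg x) (leqnn _)); rewrite cardE.
by elim: (enum _) => //= y l IHl; rewrite mulSn leq_add.
Qed.

Lemma mem_ball t x y : reach t x y -> y \in ball t x.
Proof.
elim: t x => [|t IHt] x [p [pp lp szp]].
  by case: p lp pp szp => // <- _ _; rewrite inE.
apply/flatten_mapP; case: p lp pp szp => [|z p] /= lp.
  by move=> _ _; exists x; rewrite ?inE ?eqxx //; apply: IHt; exists [::].
move=> /andP[xz pp] szp; exists z; first by rewrite inE mem_enum [_ \in _]xz orbT.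
by apply: IHt; exists p.
Qed.

End Reach.

Section WalkEdges.
Variable G : sgraph.
Implicit Types (x y : G) (w : walk G).

Definition walk_vertices w : seq G := w.1 :: w.2.

Lemma walk_edgesP w e : path (@sedge G) w.1 w.2 -> e \in walk_edges w ->
  exists x y, [/\ e = [set x; y], sedge x y,
    x \in walk_vertices w & y \in walk_vertices w].
Proof.
rewrite /walk_edges /walk_vertices; case: w => x p /=.
elim: p x => //= y p IHp x /andP[xy pp]; rewrite inE => /predU1P[->|/IHp].
  by exists x, y; rewrite !inE !eqxx orbT.
move=> /(_ pp)[a [b [-> ab aP bP]]]; exists a, b; split=> //;
  by rewrite inE ?aP ?bP orbT.
Qed.

(** The sum over F_2 of the changes of membership in [A] along the walk telescopes. *)
Lemma odd_count_crosses (A : {set G}) w : path (@sedge G) w.1 w.2 ->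
  odd (count (crosses A) (walk_edges w)) = (w.1 \in A) (+) (last w.1 w.2 \in A).
Proof.
rewrite /walk_edges; case: w => x p /=.
elim: p x => [|y p IHp] x /=; first by rewrite addbb.
move=> /andP[xy /IHp IH]; rewrite oddD IH oddb crosses_set2.
  by case: (x \in A); case: (y \in A); case: (last y p \in A).
by apply: contraTneq xy => ->; rewrite sedge_irr.
Qed.

Lemma walk_vertices_sub (A : {set G}) w : path (@sedge G) w.1 w.2 ->
  {in walk_edges w, forall e, ~~ crosses A e} -> w.1 \in A ->
  {subset walk_vertices w <= A}.
Proof.
rewrite /walk_edges /walk_vertices; case: w => x p /=.
elim: p x => [|y p IHp] x /=; first by move=> _ _ xA z; rewrite inE => /eqP->.
move=> /andP[xy pp] ncr xA z; rewrite inE => /predU1P[->//|].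
apply: IHp => // [e ep|]; first by apply: ncr; rewrite inE ep orbT.
have := ncr [set x; y]; rewrite inE eqxx crosses_set2 ?xA => [/(_ isT)/negbNE//|].
by apply: contraTneq xy => ->; rewrite sedge_irr.
Qed.

Lemma set2_eq (T : finType) (a b c d : T) : [set a; b] = [set c; d] ->
  (a = c /\ b = d) \/ (a = d /\ b = c).
Proof.
move=> eqs; have : a \in [set c; d] by rewrite -eqs set21.
have : b \in [set c; d] by rewrite -eqs set22.
have : c \in [set a; b] by rewrite eqs set21.
have : d \in [set a; b] by rewrite eqs set22.
rewrite !inE => + + /pred2P[] hb /pred2P[] ha; rewrite {}ha {}hb ?orbb; auto.
  by move=> /eqP->; auto.
by move=> _ /eqP->; auto.
Qed.

Lemma edgesP e : reflect (exists x y, sedge x y /\ e = [set x; y]) (e \in edges G).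
Proof.
rewrite inE; apply: (iffP existsP) => [[x /existsP[y /andP[xy /eqP->]]]|[x [y [xy ->]]]].
  by exists x, y.
by exists x; apply/existsP; exists y; rewrite xy eqxx.
Qed.

Lemma edges_proper (E : {set {set G}}) : E \subset edges G -> proper_edges E.
Proof.
move=> EG e /(subsetP EG)/edgesP[x [y [xy ->]]]; exists x, y; split=> //.
by apply: contraTneq xy => ->; rewrite sedge_irr.
Qed.

Lemma edges_set2 x y : ([set x; y] \in edges G) = sedge x y.
Proof.
apply/edgesP/idP => [[a [b [ab /set2_eq[[-> ->]|[-> ->]]]]]|xy] //.
  by rewrite sedge_sym.
by exists x, y.
Qed.

End WalkEdges.

Section Projection.
Variables (G H : sgraph) (m : matchings G H).
Local Notation X := (ext_graph m).

Definition proj_edge (y : {set X}) : {set G} := [set x.1 | x in y].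

Lemma proj_edge2 (a b : X) : proj_edge [set a; b] = [set a.1; b.1].
Proof. by rewrite /proj_edge imsetU1 imset_set1. Qed.

(** The steps that [destutter] drops project to singletons, which are not edges of [G]. *)
Lemma count_walk_edges_project (w : walk X) e : e \in edges G ->
  count_mem e (walk_edges (project w)) =
  count (fun y => proj_edge y == e) (walk_edges w).
Proof.
move=> /edgesP[u [v [uv def_e]]]; case: w => x p; rewrite /walk_edges /=.
have ne (a : G) : ([set a; a] == e) = false.
  apply/negbTE; apply: contraTneq uv => eqs.
  have [[<- <-]|[<- <-]] := set2_eq (etrans eqs def_e); by rewrite sedge_irr.
elim: p x => //= y p IHp x; rewrite proj_edge2.
case: eqP => [xy|_] /=; last by rewrite IHp.
by rewrite xy ne -IHp.
Qed.

Lemma ext_sedge_proj (x y : X) : sedge x y -> x.1 = y.1 \/ sedge x.1 y.1.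
Proof.
case/orP=> [/andP[/eqP->]|/existsP[e]]; first by left.
have /andP[se _] := valP e.
by case/orP=> /andP[/eqP ve _]; right; rewrite ve /= in se; rewrite // sedge_sym.
Qed.

Lemma reach_proj t (x y : X) : reach t x y -> reach t x.1 y.1.
Proof.
case=> p [+ <- {y}]; elim: p x t => [|y p IHp] x t /=.
  by exists [::].
move=> /andP[xy pp]; case: t => // t szp; have ry := IHp y t pp szp.
have [->|xy1] := ext_sedge_proj xy; first exact: reach_le ry.
rewrite -[t.+1]add1n; apply: reach_trans ry.
by exists [:: y.1]; rewrite /= xy1.
Qed.

End Projection.

(** * The code of a split *)

Section SplitCode.
Variables (d : nat) (G H : sgraph) (m : matchings G H) (h0 : H).
Local Notation X := (ext_graph m).
Variables (V' : {set G}) (E' : {set {set G}}) (f : G -> X) (Q : {set G} -> walk X).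
Variables (k r s : nat) (x0 : G).
Hypothesis degG : forall x : G, #|sedge x| <= d.
Hypothesis degH : forall x : H, #|sedge x| <= d.
Hypothesis connG : forall A : {set G}, A != set0 -> A != setT ->
  exists u v, [/\ u \in A, v \notin A & sedge u v].
Hypothesis E'G : E' \subset edges G.
Hypothesis E'V' : forall e, e \in E' -> e \subset V'.
Hypothesis missing : #|edges G :\: E'| <= r.
Hypothesis kE' : #|G| + k.*2 <= #|E'|.
Hypothesis QP : forall u v, [set u; v] \in E' -> walk_between (f u) (f v) (Q [set u; v]).
Hypothesis Qs : forall e, e \in E' -> size (Q e).2 <= s.
Hypothesis cycQ : cycle_homeomorphism E' (fun g => (f g).1) (fun e => project (Q e)).
Hypothesis near : forall g, g \in V' -> reach s g (f g).1.

(* [f] is arbitrary off [V']; there it is replaced by a point of the own cloud. *)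
Definition anchor (u : G) : X := if u \in V' then f u else (u, h0).

Lemma E'_anchor u v : [set u; v] \in E' ->
  [/\ u \in V', v \in V', anchor u = f u & anchor v = f v].
Proof.
move=> /E'V'; rewrite subUset !sub1set /anchor => /andP[uV vV].
by rewrite uV vV.
Qed.

Definition lift_edges (e : {set G}) : seq {set X} := walk_edges (Q e).

Lemma lift_edgesP e y : e \in E' -> y \in lift_edges e ->
  exists a b : X, [/\ y = [set a; b], sedge a b,
    a \in walk_vertices (Q e) & b \in walk_vertices (Q e)].
Proof.
move=> eE; have [u [v [_ def_e]]] := edges_proper E'G eE.
by rewrite def_e in eE *; have [pQ _] := QP eE; apply: walk_edgesP.
Qed.

Lemma lift_crosses (A : {set X}) u v : [set u; v] \in E' ->
  odd (count (crosses A) (lift_edges [set u; v])) = (f u \in A) (+) (f v \in A).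
Proof.
move=> uvE; have [pQ eqs] := QP uvE; rewrite odd_count_crosses //.
by have [[-> ->]|[-> ->]] := set2_eq eqs; rewrite // addbC.
Qed.

Lemma lift_cycle c e : simple_cycle (fun u v => [set u; v] \in E') c -> e \in E' ->
  parity (cycle_edges c)
    (fun e' => odd (count (fun y => proj_edge y == e) (lift_edges e')))
  = (e \in cycle_edges c).
Proof.
move=> sc eE; have eG := subsetP E'G e eE.
have /setP/(_ e) := proj2 cycQ c sc; rewrite inE eG /= => <-.
rewrite (big_morph odd (id1 := false) (op1 := addb)) //; last exact: oddD.
by apply: eq_bigr => e' _; rewrite count_walk_edges_project.
Qed.

(** The lifted walks are grouped by the ends of their edges, so that each group stays close to one
    vertex; the anchor gives even a vertex without edges in [E'] a point. *)
Definition footprint (u : G) : seq X := anchor u ::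
  flatten [seq walk_vertices (Q [set u; v]) |
    v <- enum (sedge u) & [set u; v] \in E'].

Lemma size_footprint u : size (footprint u) <= (d * s.+1).+1.
Proof.
rewrite /footprint /= ltnS size_flatten /shape -map_comp.
apply: leq_trans (leq_mul (degG u) (leqnn s.+1)); rewrite cardE.
elim: (enum _) => //= v l IHl; case: ifP => [uvE|_]; rewrite mulSn.
  by rewrite /= leq_add // ltnS Qs.
by apply: leq_trans IHl (leq_addl _ _).
Qed.

(** One [s] is for the displacement of [u] by [f], the other for the part of the walk up to [x]. *)
Lemma footprint_near u (x : X) : x \in footprint u -> reach s.*2 x.1 u.
Proof.
rewrite inE => /predU1P[->|/flatten_mapP[v]].
  rewrite /anchor; case: ifP => [uV|_]; last by exists [::].
  apply/reach_sym/(reach_le _ (near uV)).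
  by rewrite -addnn leq_addr.
rewrite mem_filter => /andP[uvE _] xQ; have [uV _ _ _] := E'_anchor uvE.
have [pQ eqs] := QP uvE; have [r1 r2] := reach_walk pQ xQ.
rewrite -addnn; apply: reach_trans (reach_sym (near uV)).
apply: reach_proj; apply: reach_le (Qs uvE) _.
by have [[<- _]|[_ <-]] := set2_eq eqs; first exact: reach_sym.
Qed.

Definition territory : {set X} := [set x | [exists u, x \in footprint u]].

Lemma walk_territory e : e \in E' -> {subset walk_vertices (Q e) <= territory}.
Proof.
move=> eE x xQ; have /edgesP[u [v [uv def_e]]] := subsetP E'G e eE.
rewrite inE; apply/existsP; exists u; rewrite inE; apply/orP; right.
apply/flatten_mapP; exists v; last by rewrite -def_e.
by rewrite mem_filter mem_enum -def_e eE.
Qed.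

Lemma card_territory : #|territory| <= #|G| * (d * s.+1).+1.
Proof.
apply: (@leq_trans (size (flatten [seq footprint u | u <- enum G]))).
  apply: leq_trans (card_size _); apply: subset_leq_card.
  apply/subsetP => x; rewrite inE => /existsP[u xu].
  by apply/flatten_mapP; exists u; rewrite ?mem_enum.
rewrite size_flatten /shape -map_comp cardE.
by elim: (enum _) => //= u l IHl; rewrite mulSn leq_add ?size_footprint.
Qed.

(** Only footprints of vertices within [s.*2] of [g] meet its cloud. *)
Lemma card_territory_cloud g :
  #|[set h | ((g, h) : X) \in territory]| <= d.+1 ^ s.*2 * (d * s.+1).+1.
Proof.
pose l := flatten [seq footprint u | u <- ball s.*2 g].
apply: (@leq_trans (size [seq x.2 | x : X <- l])).
  apply: leq_trans (card_size _); apply: subset_leq_card.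
  apply/subsetP => h; rewrite !inE => /existsP[u xu].
  apply/mapP; exists (g, h) => //; apply/flatten_mapP; exists u => //.
  by apply: mem_ball; apply: (footprint_near xu).
rewrite size_map; apply: leq_trans (leq_mul (size_ball s.*2 g degG) (leqnn _)).
rewrite /l size_flatten /shape -map_comp.
by elim: (ball _ _) => //= u b IHb; rewrite mulSn leq_add ?size_footprint.
Qed.

(** Both ends of each edge outside [E']: no lifted walk connects them, so the tour has to jump. *)
Definition roots : seq X :=
  [seq anchor u | u <- flatten [seq enum (e : {set G}) | e <- enum (edges G :\: E')]].

Lemma size_roots : size roots <= r.*2.
Proof.
rewrite size_map size_flatten /shape -map_comp.
apply: leq_trans (_ : #|edges G :\: E'|.*2 <= _); last by rewrite leq_double.
rewrite cardE; have : all (mem (edges G)) (enum (edges G :\: E')).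
  by apply/allP => e; rewrite mem_enum inE => /andP[].
elim: (enum _) => //= e l IHl /andP[eG /IHl lel]; rewrite doubleS -addn2 addnC.
apply: leq_add => //; rewrite -cardE; have [u [v [_ ->]]] := edgesP _ eG.
by rewrite cards2; case: eqP.
Qed.

Lemma exists_split_code c B K :
  r.*2 <= c -> c + (#|G| * (d * s.+1).+1).*2 <= B ->
  d.+1 ^ s.*2 * (d * s.+1).+1 <= K ->
  exists q : ext_code d G H c B K, encodes h0 k q m.
Proof.
move=> lec leB leK.
have [F [szF uF FP Fcut]] :=
  exists_cut_edges (edges_proper E'G) lift_crosses lift_cycle kE'.
pose kept := [rel a b : X |
  [exists e in E', [set a; b] \in lift_edges e] && ([set a; b] \notin F)].
(* Repeating the starting point pads the roots to length exactly [c]; [take] removes nothing. *)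
have szR : size (take c roots ++ nseq (c - size roots) (anchor x0)) == c.
  rewrite size_cat size_nseq size_take_min.
  have le := leq_trans size_roots lec; rewrite (minn_idPr le) subnKC //.
have rootsT : {subset anchor x0 :: Tuple szR <= territory}.
  move=> x; rewrite inE /= mem_cat => xR; rewrite inE; apply/existsP.
  have [u ->] : exists u, x = anchor u; last by exists u; rewrite inE eqxx.
  case/or3P: xR => [/eqP->|/mem_take/mapP[u _ ->]|]; [by exists x0|by exists u|].
  by rewrite mem_nseq => /andP[_ /eqP->]; exists x0.
(* A member of [F] projects to an edge of [G], so it is not inside a cloud and belongs to a
   matching. *)
have FE y : y \in F -> exists (e : oriented_edge G) h,
    [/\ y = [set ((val e).1, h); ((val e).2, m e h)] :> {set X},
        proj_edge y = [set (val e).1; (val e).2] &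
        exists2 e', e' \in E' & y \in lift_edges e'].
  move=> yF; have [pyE [e' e'E yW]] := FP y yF.
  have [[a1 a2] [[b1 b2] [def_y ab _ _]]] := lift_edgesP e'E yW.
  subst y; have := subsetP E'G _ pyE; rewrite proj_edge2 edges_set2 /= => ab1.
  case/orP: ab => [/andP[/eqP/= ab _]|]; first by rewrite ab sedge_irr in ab1.
  case/existsP=> e /= /orP[] /andP[/eqP ve /eqP me].
    by exists e, a2; rewrite ve me; split => //; exists e'.
  by exists e, b2; rewrite ve me; split; [rewrite setUC | rewrite setUC | exists e'].
pose Fe (e : oriented_edge G) : option H :=
  [pick h | ([set ((val e).1, h); ((val e).2, m e h)] : {set X}) \in F].
apply: (@exists_code d G H degG degH h0 c B K k m kept territory (anchor x0)
  (Tuple szR) Fe).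
- by apply: leq_trans leB; rewrite leq_add2l leq_double card_territory.
- by move=> a b; rewrite /kept /= setUC.
- move=> a b /andP[/exists_inP[e eE abW] _].
  have [a' [b' [/set2_eq eqs a'b' _ _]]] := lift_edgesP eE abW.
  by case: eqs => -[-> ->] //; rewrite sedge_sym.
- move=> a _ b /andP[/exists_inP[e eE abW] _].
  have [a' [b' [/set2_eq eqs a'b' a'Q b'Q]]] := lift_edgesP eE abW.
  by apply: (walk_territory eE); case: eqs => -[_ ->].
- exact: rootsT.
(* By [Fcut] no lifted edge crosses [A], with or without [F]. Membership of anchors in [A] is thus
   constant along [E'], and at all other edges of [G] both anchors are roots. As [G] is connected,
   [A] contains all anchors, hence all lifted walks. *)
- move=> A rootA keptA.
  have ncr e y : e \in E' -> y \in lift_edges e -> ~~ crosses A y.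
    apply: Fcut => {}e {}y eE yW yF.
    have [a [b [def_y ab _ _]]] := lift_edgesP eE yW.
    have kab : kept a b by rewrite /= -def_y yF andbT; apply/exists_inP; exists e.
    have kba : kept b a by move: kab; rewrite /= setUC.
    rewrite def_y crosses_set2; last by apply: contraTneq ab => ->; rewrite sedge_irr.
    have -> : (a \in A) = (b \in A); last by rewrite addbb.
    by apply/idP/idP => zA; [apply: keptA kab | apply: keptA kba].
  have cutf u v : [set u; v] \in E' -> (f u \in A) = (f v \in A).
    move=> uvE; have := lift_crosses A uvE.
    rewrite (eq_in_count (a2 := pred0)) => [|y /(ncr _ _ uvE)/negbTE //].
    by rewrite count_pred0; case: (f u \in A); case: (f v \in A).
  have all_anchor u : anchor u \in A.
    suff /setP/(_ u) : [set u | anchor u \in A] = setT by rewrite !inE.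
    apply/eqP/negPn/negP => /connG[].
      by apply/set0Pn; exists x0; rewrite inE; apply: rootA; rewrite inE eqxx.
    move=> v [w []]; rewrite !inE => vA wA vw.
    have [vwE|vwE] := boolP ([set v; w] \in E').
      have [_ _ av aw] := E'_anchor vwE.
      by move: wA; rewrite aw -(cutf _ _ vwE) -av vA.
    case/negP: wA; apply: rootA; rewrite inE /= mem_cat take_oversize.
      apply/or3P/Or32; apply: map_f; apply/flatten_mapP; exists [set v; w].
        by rewrite mem_enum inE vwE edges_set2.
      by rewrite mem_enum set22.
    exact: leq_trans size_roots lec.
  apply/subsetP => x; rewrite inE => /existsP[u]; rewrite inE.
  case/predU1P=> [->//|/flatten_mapP[v]]; rewrite mem_filter => /andP[uvE _].
  have [pQ eqs] := QP uvE; apply: walk_vertices_sub => //.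
    by move=> y; apply: ncr.
  have [_ _ au av] := E'_anchor uvE.
  by have [[-> _]|[-> _]] := set2_eq eqs; rewrite -?au -?av.
- by move=> g; apply: leq_trans leK; apply: card_territory_cloud.
(* The members of [F] have distinct projections, so they belong to at least [k] distinct edges of
   [G]. *)
- rewrite -szF -(size_map (@proj_edge G H m) F) -(card_uniqP uF).
  apply: leq_trans (leq_imset_card
    (fun e : oriented_edge G => [set (val e).1; (val e).2]) _).
  apply: subset_leq_card; apply/subsetP => _ /mapP[y yF ->].
  have [e [h [def_y -> _]]] := FE y yF; apply: imset_f; rewrite inE /Fe.
  by case: pickP => // /(_ h); rewrite -def_y yF.
move=> e h; rewrite /Fe; case: pickP => // h' yF [eqh]; rewrite {}eqh in yF *.
have [pyE [e' e'E yW]] := FP _ yF.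
have [a [b [/set2_eq eqs _ aQ bQ]]] := lift_edgesP e'E yW.
have {}aQ := walk_territory e'E aQ; have {}bQ := walk_territory e'E bQ.
split; last by rewrite /= yF andbF.
- by case: eqs => -[-> _].
- by case: eqs => -[_ ->].
Qed.

End SplitCode.

(** * Counting *)

Section Degrees.
Variables (d : nat) (G : sgraph).

Lemma cayley_degree (x : G) : cayley_graph d G -> #|sedge x| = d.
Proof.
case=> gT [S [f [[<- _ _ _] [bijf fE]]]].
have bijh : bijective (fun y => (f x)^-1 * f y)%g.
  apply: (@bij_comp _ _ _ (fun z => (f x)^-1 * z)%g) => //.
  by exists (fun z => f x * z)%g => z; rewrite (mulKVg, mulKg).
rewrite -(on_card_preimset (f := fun y => ((f x)^-1 * f y)%g) (R := S)).
  by apply: eq_card => y; rewrite inE -fE.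
by case: bijh => g gK Kg; exists g => z _.
Qed.

Hypothesis degG : forall x : G, #|sedge x| = d.

Definition arcs : {set G * G} := [set p | sedge p.1 p.2].

Lemma card_arcs : #|arcs| = #|G| * d.
Proof.
rewrite -sum1_card (eq_bigl (fun p => true && sedge p.1 p.2)); last first.
  by move=> p; rewrite inE.
rewrite -(pair_big_dep predT (fun x y => sedge x y) (fun _ _ => 1)) /=.
rewrite (eq_bigr (fun=> d)) ?sum_nat_const // => x _.
by rewrite sum1_card -(degG x).
Qed.

Lemma card_edges_le : #|edges G| <= #|G| * d.
Proof.
rewrite -card_arcs; apply: leq_trans (leq_imset_card (fun p => [set p.1; p.2]) _).
apply: subset_leq_card; apply/subsetP => _ /edgesP[x [y [xy ->]]].
by apply/imsetP; exists (x, y); rewrite ?inE.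
Qed.

(** An arc is determined by its edge and one bit for its direction. *)
Lemma card_edges_ge : #|G| * d <= #|edges G|.*2.
Proof.
pose f (p : G * G) := ([set p.1; p.2], (enum_rank p.1 < enum_rank p.2)%N).
have finj : {in arcs &, injective f}.
  move=> [a b] [a' b']; rewrite !inE /f /= => ab _ [/set2_eq eqs eqr].
  case: eqs => [[-> ->]//|[eqa eqb]]; subst a' b'.
  have : enum_rank a != enum_rank b.
    by rewrite (inj_eq enum_rank_inj); apply: contraTneq ab => ->; rewrite sedge_irr.
  by move: eqr; rewrite -val_eqE /=; case: ltngtP.
rewrite -card_arcs -(card_in_imset finj) -muln2 -card_bool -cardsT -cardsX.
apply: subset_leq_card; apply/subsetP => _ /imsetP[[x y] xy ->].
by move: xy; rewrite in_setX in_setT andbT /= edges_set2 inE.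
Qed.

Lemma card_oriented_edge : #|{: oriented_edge G}| <= #|G| * d.
Proof.
rewrite card_sig -card_arcs; apply: subset_leq_card.
by apply/subsetP => p; rewrite !inE => /andP[].
Qed.

End Degrees.

Lemma expn_ge_mulD a s : a * s + 1 <= a.+1 ^ s.
Proof. by elim: s => [|s IHs]; rewrite ?muln0 // expnS; nia. Qed.

(** The inequality of [code_count_lt] for exponents to base [d.*2.+2]. The left side is a small
    fraction of [t * n], the right side close to [t * n / 8]. *)
Lemma exponent_bound d n t r s :
  100 * d + 100 <= t -> 200 <= n -> 1000 * r <= n -> 1000 * (d * s) <= t.+1 ->
  2 * t.+1 * (r.*2).+1 + (r.*2 + (n * (d * s.+1).+1).*2)
    + (6 * s + 3) * (n * d) < t.-1 * (n %/ 8).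
Proof.
move=> tb nb rb sb.
have p1 : t.+1 * (1000 * r) <= t.+1 * n by rewrite leq_mul2l rb orbT.
have p2 : n * (1000 * (d * s)) <= n * t.+1 by rewrite leq_mul2l sb orbT.
have p3 : n * (100 * d + 100) <= n * t by rewrite leq_mul2l tb orbT.
have p4 : t * 200 <= t * n by rewrite leq_mul2l nb orbT.
have q8 : n <= 8 * (n %/ 8) + 7 by lia.
have p5 : t.-1 * n <= t.-1 * (8 * (n %/ 8) + 7) by rewrite leq_mul2l q8 orbT.
have tE : t = t.-1 + 1 by lia.
move: (n %/ 8) p5 => q p5 {q8}; move: tE p1 p2 p3 p4 p5 tb sb.
move: t.-1 => u ->; rewrite -!addnn => *; nia.
Qed.

Lemma code_count_lt d n t r s :
  let K := d.+1 ^ s.*2 * (d * s.+1).+1 in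
  d.*2.+2 ^ t <= n -> n < d.*2.+2 ^ t.+1 ->
  100 * d + 100 <= t -> 1000 * r <= n -> 1000 * (d * s) <= t.+1 ->
  0 < d ->
  K < n /\
  (n * n) ^ (r.*2).+1 * (d.*2.+2) ^ (r.*2 + (n * (d * s.+1).+1).*2) *
    (K ^ 2).+1 ^ (n * d) < (n - K) ^ (n %/ 8).
Proof.
set D := d.*2.+2 => K Dt nD tb rb sb d0.
have s'b : 1000 * s <= t.+1 by nia.
have D2 : 2 <= D by rewrite /D -addnn; lia.
have D0 : 0 < D by lia.
have n200 : 200 <= n.
  apply: leq_trans Dt; apply: (@leq_trans (2 ^ t)); last by rewrite leq_exp2r //; lia.
  apply: (@leq_trans (2 ^ 8)) => //; rewrite leq_exp2l //; lia.
(* The ball contributes at most [D ^ s.*2]; the footprint at most [D ^ s.+1], by Bernoulli's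
   inequality. *)
have KD : K <= D ^ (3 * s + 1).
  have -> : 3 * s + 1 = s.*2 + s.+1 by rewrite -addnn; lia.
  rewrite expnD leq_mul //; last first.
    rewrite -addn1; apply: leq_trans (expn_ge_mulD _ _) _.
    by rewrite leq_exp2r // /D -addnn; lia.
  case: (s) => // s1; rewrite leq_exp2r // ?double_gt0 // /D -addnn; lia.
have tE : t = t.-1.+1 by lia.
have KD1 : K <= D ^ t.-1.
  by apply: leq_trans KD _; rewrite leq_exp2l //; lia.
(* Giving up one factor [D] leaves room to subtract [K]: [n - K] is still at least [D ^ t.-1]. *)
have Dn : 2 * D ^ t.-1 <= n.
  by apply: leq_trans Dt; rewrite [X in _ <= _ ^ X]tE expnS leq_mul2r D2 orbT.
have D10 : 0 < D ^ t.-1 by rewrite expn_gt0 D0.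
have nK : D ^ t.-1 <= n - K by lia.
split; first by lia.
apply: leq_trans (_ : (D ^ t.-1) ^ (n %/ 8) <= _); last first.
  by rewrite leq_exp2r //; lia.
rewrite -expnM; apply: leq_ltn_trans (_ : D ^ (2 * t.+1 * (r.*2).+1
   + (r.*2 + (n * (d * s.+1).+1).*2) + (6 * s + 3) * (n * d)) < _); last first.
  by rewrite ltn_exp2l //; apply: exponent_bound.
rewrite !expnD; apply: leq_mul; last first.
  have [->|nd0] := posnP (n * d); first by rewrite muln0 !expn0.
  rewrite [leqRHS]expnM leq_exp2r //.
  apply: leq_ltn_trans (_ : D ^ (6 * s + 2) < _); last by rewrite ltn_exp2l //; lia.
  have -> : 6 * s + 2 = (3 * s + 1) * 2 by lia.
  by rewrite expnM leq_exp2r.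
apply: leq_mul; last by rewrite -expnD.
rewrite expnM leq_exp2r // mulnC expnM -mulnn leq_mul //; exact: ltnW.
Qed.

(* Real estimates and the choice of constants *)
From mathcomp Require Import all_classical all_reals all_analysis lra.
Import Order.TTheory GRing.Theory Num.Theory.
Local Close Scope set_scope.
Local Open Scope ring_scope.

Section RealBounds.
Variable R : realType.

(** Expansion gives an edge out of any nonempty set of at most half the vertices; a larger set is
    replaced by its complement. *)
Lemma expander_connected (phi : R) (G : sgraph) (A : {set G}) :
  0 < phi -> expander phi G -> A != finset.set0 -> A != finset.setT ->
  exists u v, [/\ u \in A, v \notin A & sedge u v].
Proof.
move=> phi0 expG.
have cut (B : {set G}) : B != finset.set0 -> (2 * #|B| <= #|G|)%N ->
    exists u v, [/\ u \in B, v \notin B & sedge u v].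
  rewrite -card_gt0 => B0 /expG; rewrite leNgt => /negP hlt.
  have : (0 < #|[set p : G * G | [&& p.1 \in B, p.2 \notin B & sedge p.1 p.2]]%SET|)%N.
    rewrite lt0n; apply/eqP => card0; apply: hlt; rewrite card0 mulr_gt0 // ltr0n //.
  by move=> /card_gt0P[[u v]]; rewrite inE => /and3P[]; exists u, v.
move=> A0 AT; have [leA|ltA] := leqP (2 * #|A|) #|G|; first exact: cut.
have [||u [v []]] := cut (finset.setC A).
- by apply: contraNneq AT => A0c; rewrite -(finset.setCK A) A0c finset.setC0.
- by have := cardsC A; lia.
rewrite !inE negbK => uA vA uv; exists v, u; split => //.
by rewrite sedge_sym.
Qed.

Lemma walk_length_ge (G : sgraph) (l : G -> G -> R) (b : R) (w : walk G) :
  (forall x y, b <= l x y) -> (size w.2)%:R * b <= walk_length l w.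
Proof.
move=> lb; rewrite /walk_length; case: w => x p /=.
elim: p x => [|y p IHp] x /=; first by rewrite big_nil mul0r.
by rewrite big_cons -add1n natrD mulrDl mul1r lerD.
Qed.

(** As [ln #|G|%:R] is at least 1, each edge has length at least its power [1 / 3], and dividing
    [4 / 3] by that power leaves exponent 1. *)
Lemma shortest_walk_size (G H : sgraph) (m : matchings G H) (eps : R)
    (x y : ext_graph m) (w : walk (ext_graph m)) :
  1 <= ln #|G|%:R :> R ->
  shortest_path (@ext_length R G H m) x y w ->
  (path_dist (@ext_length R G H m) x y < (eps * ln #|G|%:R `^ (4 / 3))%:E)%E ->
  (size w.2)%:R < eps * ln #|G|%:R.
Proof.
set L := ln _ => L1 [_ wmin] /ereal_inf_lt[_ [w' /wmin ww' <-]]; rewrite lte_fin => ltw.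
have L0 : 0 < L by apply: lt_le_trans L1.
have b0 : 0 < L `^ (1 / 3) by apply: powR_gt0.
rewrite -(ltr_pM2r b0) -mulrA.
have -> : L * L `^ (1 / 3) = L `^ (4 / 3).
  rewrite -[X in X * _](powRr1 (ltW L0)) -powRD; first by congr powR; lra.
  by rewrite (gt_eqF L0) implybT.
apply: le_lt_trans ltw; apply: le_trans ww'; apply: walk_length_ge => a b.
rewrite /ext_length; case: ifP => // _; apply: ler_powR => //; lra.
Qed.

Lemma shortest_walk_reach (G : sgraph) (x y : G) (l : G -> G -> R) (w : walk G) t :
  shortest_path l x y w -> (size w.2 <= t)%N -> reach t x y.
Proof.
move=> [[pw eqs] _] lew; have rw : reach t w.1 (last w.1 w.2) by exists w.2.
by have [[<- <-]|[<- <-]] := set2_eq eqs; last exact: reach_sym.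
Qed.

(** Every single outcome has positive probability, so one good [m] is enough. *)
Lemma ext_prob_gt0 (G H : sgraph) (A : matchings G H -> Prop) m :
  A m -> 0 < ext_prob R A.
Proof.
move=> Am; have perm_gt0 : 0 < (#|{perm H}|%:R)^-1 :> R.
  by rewrite invr_gt0 ltr0n; apply/card_gt0P; exists 1%g.
rewrite /ext_prob (bigD1 m) /=; last exact/asboolP.
rewrite ltr_pwDl //; first by apply: prodr_gt0 => e _.
by apply: sumr_ge0 => m' _; apply: prodr_ge0 => e _; apply: ltW.
Qed.

End RealBounds.

Lemma split_encoded (R : realType) (d : nat) (phi eps : R) (G H : sgraph)
    (m : matchings G H) (V' : {set G}) (E' : {set {set G}})
    (f : G -> ext_graph m) (h0 : H) :
  let n := #|G| in let L := ln n%:R in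
  let r := Num.trunc (eps * (n * d)%:R) in let s := Num.trunc (eps * L) in
  (3 <= d)%N -> 0 < phi -> expander phi G ->
  (forall x : G, #|sedge x| = d) -> (forall x : H, #|sedge x| = d) ->
  0 < eps -> 6 * eps <= 1 -> 1 <= L ->
  is_split (eps * L `^ (4 / 3)) eps V' E' f ->
  exists q : ext_code d G H r.*2 (r.*2 + (n * (d * s.+1).+1).*2)
    (d.+1 ^ s.*2 * (d * s.+1).+1), encodes h0 (n %/ 8) q m.
Proof.
move=> n L r s d3 phi0 expG degG degH eps0 eps6 L1.
case=> -[E'G E'V'] cardE' [Q [shortQ cycQ]] distE near.
have n0 : (0 < n)%N.
  rewrite lt0n; apply/eqP => n0; move: L1; rewrite /L n0 ln0 //.
  by rewrite ler10.
have [x0 _] : exists x0 : G, x0 \in G by apply/card_gt0P.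
have leE := card_edges_le degG; have geE := card_edges_ge degG.
apply: (@exists_split_code d G H m h0 V' E' f Q (n %/ 8) r s x0) => //.
- by move=> x; rewrite degG.
- by move=> x; rewrite degH.
- by move=> A; apply: expander_connected phi0 expG.
- rewrite truncn_ge_nat; last by rewrite mulr_ge0 // ltW.
  rewrite finset.cardsD (finset.setIidPr E'G) natrB ?subset_leq_card //.
  apply: le_trans (_ : eps * #|edges G|%:R <= _); first by lra.
  by rewrite ler_pM2l // ler_nat.
(* Since [d] is at least 3 and [eps] at most 1/6, [E'] has at least (5/6)(3n/2) = 5n/4 edges, which
   leaves room for [k = n %/ 8]. *)
- have le1 : (3 * n <= 2 * #|edges G|)%N by nia.
  have le2 : (8 * (n + 2 * (n %/ 8)) <= 10 * n)%N by lia.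
  rewrite -mul2n -(ler_nat R); apply: le_trans cardE'.
  move: le1 le2; rewrite -!(ler_nat R) !natrM.
  move: (#|edges G|%:R) ((n + _)%:R) => x y le1 le2.
  have n0' : 0 < n%:R :> R by rewrite ltr0n.
  have x0' : 0 <= x by lra.
  nra.
- by move=> u v /shortQ[].
- move=> e eE; have [u [v [_ def_e]]] := edges_proper E'G eE.
  rewrite def_e in eE *; rewrite truncn_ge_nat; last first.
    by rewrite mulr_ge0 // ltW // (lt_le_trans _ L1).
  exact: ltW (shortest_walk_size L1 (shortQ u v eE) (distE u v eE)).
move=> g /near[w sw szw]; apply: shortest_walk_reach sw _.
by rewrite truncn_ge_nat // mulr_ge0 // ltW // (lt_le_trans _ L1).
Qed.

Theorem theorem5p3 (R : realType) (d : nat) (hd : (3 <= d)%N)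
    (phi gamma : R) (hphi : 0 < phi) (hgamma : 0 < gamma) :
  exists2 eps0 : R, 0 < eps0 &
  forall eps : R, 0 < eps -> eps < eps0 ->
  exists N : nat, forall n : nat, (N <= n)%N ->
  forall G H : sgraph,
    #|G| = n -> #|H| = n ->
    cayley_graph d G -> cayley_graph d H ->
    expander phi G -> expander phi H ->
    ((gamma * ln n%:R)%:E <= girth R G)%E ->
    0 < ext_prob R (fun m : matchings G H =>
          ~ exists (V' : {set G}) (E' : {set {set G}}) (f : G -> ext_graph m),
              is_split (eps * ln n%:R `^ (4 / 3)) eps V' E' f).
Proof.
set a : R := ln (d.*2.+2)%:R.
have a0 : 0 < a by rewrite ln_gt0 // ltr1n.
have d0 : 0 < d%:R :> R by rewrite ltr0n; lia.
have e0 : 0 < 1000 * (a + 1) * d%:R :> R.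
  by have := mulr_gt0 (addr_gt0 a0 ltr01) d0; lra.
(* This makes both [1000 * eps * d] and [1000 * eps * a * d] less than 1, which bounds [r] by
   [n / 1000] and [d * s] by [t.+1 / 1000]. *)
exists (1000 * (a + 1) * d%:R)^-1; first by rewrite invr_gt0; exact: e0.
move=> eps eps0; rewrite -[X in _ < X]mul1r (ltr_pdivlMr _ _ e0) => leps.
have epsd : 0 < eps * d%:R by rewrite mulr_gt0.
have epsd1 : eps <= eps * d%:R.
  by rewrite ler_peMr ?ler1n ?(ltnW (ltnW hd)) // ltW.
have epsad : 0 < eps * a * d%:R by rewrite !mulr_gt0.
(* The first bound gives [100 * d + 100 <= t], the second [1 <= ln n]. *)
exists (maxn (d.*2.+2 ^ (100 * d + 100)) (Num.trunc (expR 1 : R)).+1).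
move=> n; rewrite geq_max => /andP[nD ne] G H cardG cardH cayG cayH expG _ _.
have n_gt0 : (0 < n)%N by apply: leq_trans ne.
have L1 : 1 <= ln n%:R :> R.
  rewrite -[leLHS](expRK (1 : R)) ler_ln ?posrE ?expR_gt0 ?ltr0n //.
  by apply: ltW; rewrite -truncn_lt_nat ?expR_ge0.
set t := trunc_log d.*2.+2 n.
have [Dt nDt] : (d.*2.+2 ^ t <= n)%N /\ (n < d.*2.+2 ^ t.+1)%N.
  by apply/andP; apply: trunc_log_bounds.
have tb : (100 * d + 100 <= t)%N by apply: trunc_log_max.
have Lt : ln n%:R <= t.+1%:R * a.
  rewrite /a mulr_natl -lnXn ?ltr0n // ler_ln ?posrE ?exprn_gt0 ?ltr0n //.
  by rewrite -natrX ler_nat ltnW.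
have degG (x : G) : #|sedge x| = d by apply: cayley_degree.
have degH (x : H) : #|sedge x| = d by apply: cayley_degree.
have [h0 _] : exists h0 : H, h0 \in H by apply/card_gt0P; rewrite cardH.
set r := Num.trunc (eps * (n * d)%:R : R); set s := Num.trunc (eps * ln n%:R : R).
have rb : r%:R <= eps * n%:R * d%:R :> R.
  have : r%:R <= eps * (n * d)%:R :> R.
    by rewrite -truncn_ge_nat // mulr_ge0 // ltW.
  by rewrite natrM mulrA.
have sb : s%:R <= eps * a * t.+1%:R :> R.
  apply: le_trans (_ : eps * ln n%:R <= _).
    by rewrite -truncn_ge_nat // mulr_ge0 ?(ltW eps0) // (le_trans _ L1).
  by rewrite -mulrA ler_pM2l // [a * _]mulrC.
have rn : (1000 * r <= n)%N.
  rewrite -(ler_nat R) natrM; have : 0 <= n%:R :> R by [].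
  move: (n%:R) rb => x rb x0; nra.
have sn : (1000 * (d * s) <= t.+1)%N.
  rewrite -(ler_nat R) !natrM; have : 0 <= t.+1%:R :> R by [].
  have : d%:R * s%:R <= d%:R * (eps * a * t.+1%:R) :> R by rewrite ler_pM2l.
  move: (t.+1%:R) (s%:R) => x y xy x0; nra.
have [] := code_count_lt Dt nDt tb rn sn (ltnW (ltnW hd)).
set K := (_ * _)%N => Kn count_lt.
have [||m mP] := @exists_not_encoded d G H h0 r.*2
  (r.*2 + (n * (d * s.+1).+1).*2) K (n %/ 8).
- by rewrite cardH.
- have := card_oriented_edge degG; set o := #|{: oriented_edge G}|.
  rewrite cardG cardH => leo; apply: leq_ltn_trans count_lt.
  by rewrite leq_mul2l leq_pexp2l ?orbT.
apply: (@ext_prob_gt0 R G H _ m) => -[V' [E' [f split_f]]].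
subst n; have [] := @split_encoded R d phi eps G H m V' E' f h0 hd hphi expG degG degH
  eps0 _ L1 split_f.
  by move: epsd1 leps epsad epsd; clear; lra.
by move=> q; apply/negP; apply: mP.
Qed.
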